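(* Let $\{M_n, n\ge 1\}$ be a sequence of real-valued random variables and let $\{W(t), t\ge 0\}$ be a standard Brownian motion defined on the same probability space. Let $0\le b_0<b_1<b_2<\cdots$ be a (deterministic) increasing sequence such that $b_n\to\infty$ and $b_{n+1}-b_n=o(b_n/\log\log b_n)$ as $n\to\infty$. Suppose that $$M_n-W(b_n)=o(\sqrt{b_n})\quad\text{almost surely as } n\to\infty.$$ Then for every $f\in\mathcal{C}_e(\mathbb{R})$, $$\frac{1}{\log b_n}\sum_{k=1}^{n}\frac{b_k-b_{k-1}}{b_k}\,f\left(\frac{M_k}{\sqrt{b_k}}\right)\longrightarrow \mathbb{E}f(\mathbf{Z})\quad\text{almost surely as } n\to\infty.$$
   Context: $\mathbf{Z}$ denotes a standard normal random variable. $\mathcal{C}_e(\mathbb{R})$ is the class of continuous functions $f:\mathbb{R}\to\mathbb{R}$ for which there is some $\gamma<1/2$ with $|f(x)|\le e^{\gamma x^2}$ for all $x\in\mathbb{R}$. Expressions such as $\log\log b_n$ and $1/\log b_n$ are considered for $n$ large enough that they are defined and positive. *)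

(* Defs.v *)
From HB Require Import structures.
From mathcomp Require Export all_boot all_order all_algebra finmap.
From mathcomp Require Export all_classical all_reals all_analysis.
Export Order.TTheory GRing.Theory Num.Theory.
Export numFieldNormedType.Exports.

Set Implicit Arguments.
Unset Strict Implicit.
Unset Printing Implicit Defensive.

Local Open Scope classical_set_scope.
Local Open Scope ring_scope.

Section definitions.
Context {R : realType} {d : measure_display} {Omega : measurableType d}.
Variable P : probability Omega R.

(* The law is compared on Borel sets only: a measure has unspecified values on
   nonmeasurable sets, so equality of the two set functions would say too much.
   The last parameter of [normal_prob] is the standard deviation. *)
Definition normally_distributed (X : Omega -> R) (m sigma : R) : Prop :=
  forall A : set R, measurable A -> P (X @^-1` A) = normal_prob m sigma A.

Definition mutually_independent (I : choiceType) (X : I -> Omega -> R) : Prop :=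
  forall (J : {fset I}) (A : I -> set R),
    (forall i, i \in J -> measurable (A i)) ->
    P (\bigcap_(i in [set` J]) (X i @^-1` A i)) =
    (\prod_(i <- J) P (X i @^-1` A i))%E.

(* Only the values [W t] with [0 <= t] matter. *)
Record standard_brownian_motion (W : R -> {RV P >-> R}) : Prop := {
  bm_start : {ae P, forall w, W 0 w = 0} ;
  bm_independent_increments : forall (n : nat) (t : nat -> R),
    0 <= t 0%N -> (forall i, (i < n)%N -> t i <= t i.+1) ->
    mutually_independent (fun (i : 'I_n) w => W (t i.+1) w - W (t i) w) ;
  bm_normal_increments : forall s t : R, 0 <= s -> s < t ->
    normally_distributed (fun w => W t w - W s w) 0 (Num.sqrt (t - s)) ;
  bm_continuous_paths :
    {ae P, forall w, {within `[0, +oo[, continuous (fun t : R => W t w)}}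
}.

End definitions.

Definition class_Ce {R : realType} (f : R -> R) : Prop :=
  continuous f /\
  exists2 gamma : R, gamma < 1 / 2 &
    forall x : R, `|f x| <= expR (gamma * x ^+ 2).

(* Main.v *)
From HB Require Import structures.
Require Import Defs.
From mathcomp Require Import measurable_realfun ring lra zify.

(** On the logarithmic time scale [s = ln t] the process [W t / sqrt t] is
    stationary and forgets its past exponentially fast, and the step from
    [b_{k-1}] to [b_k] occupies a length asymptotic to the weight
    [a_k = (b_k - b_{k-1}) / b_k].  The theorem is therefore a law of large
    numbers for the weighted averages of [f (X_k)], where
    [X_k = W(b_k) / sqrt b_k] is standard normal.  The difficulty is that
    [f] may grow like [exp (l x^2)] with [l] close to [1/2], so that [f (X_k)]
    has a moment of some order above 1 but in general no variance.

    The average is controlled in [L1], with a rate, for functions [G] of the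
    same growth that are also locally Lipschitz (predicate [tame]).  For a large
    [h], let [Z_k] be the normalized increment of [W] over [[b_k / h, b_k]].
    Then [X_k - Z_k] is of size [h^(-1/2)], so replacing [X_k] by [Z_k] costs
    little in [L1]; and [Z_j], [Z_k] are independent as soon as
    [b_j <= b_k / h].  After truncating [G] where [x^2 > kappa], the second
    moment of the centred sum sees only pairs within logarithmic distance
    [ln h] of each other.  With [h] and the truncated [G] both exponential
    in [kappa], and a total weight of at least [exp (4 kappa)], all the errors are
    exponentially small in [kappa] ([weighted_sum_L1]).

    Along the indices at which the total weight passes [(i + 1)^p] these rates
    are summable for [p] large, which gives almost sure convergence there; since
    consecutive thresholds have ratio tending to 1, the sums of a nonnegative
    [G] are squeezed in between ([cvg_weighted_average_passage],
    [tame_average]).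

    Two deterministic steps remain on almost every path.  Replacing [X_k] by
    [M_k / sqrt b_k], which is at a distance tending to 0, changes a tame
    average by a vanishing multiple of a convergent one
    ([cvg_tame_average_perturb]).  And a function of the class is, relatively to
    a slightly larger Gaussian weight, a uniform limit of tame functions
    ([class_Ce_tame_approx]), while the average of that weight converges.
    Finally the total weight is asymptotic to [ln (b n)]
    ([total_weight_equiv]). *)

Set Implicit Arguments.
Unset Strict Implicit.
Unset Printing Implicit Defensive.

Local Open Scope classical_set_scope.
Local Open Scope ring_scope.

(** * Gaussian weights and tame functions *)

Definition gexp {R : realType} (l x : R) : R := expR (l * x ^+ 2).

Section gaussian_weight.
Context {R : realType}.
Implicit Types l x y v : R.

Lemma gexp_ge0 l x : 0 <= gexp l x. Proof. exact: expR_ge0. Qed.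

Lemma ler_gexp l l' x : l <= l' -> gexp l x <= gexp l' x.
Proof. by move=> ll'; rewrite /gexp ler_expR ler_wpM2r// sqr_ge0. Qed.

Lemma gexpM l l' x : gexp l x * gexp l' x = gexp (l + l') x.
Proof. by rewrite /gexp -expRD mulrDl. Qed.

Lemma continuous_gexp l : continuous (gexp l).
Proof.
move=> x; rewrite /gexp; apply: (cvg_comp (fun x => l * x ^+ 2) expR).
  by apply: cvgM; [exact: cvg_cst|exact: exprn_continuous].
exact: continuous_expR.
Qed.

Lemma measurable_gexp l : measurable_fun setT (gexp l).
Proof. exact: continuous_measurable_fun (@continuous_gexp l). Qed.

(** A linear factor is absorbed by an arbitrarily small Gaussian exponent; all
    growth estimates below spend a little of the exponent in this way. *)
Lemma normr_le_gexp e x : 0 < e -> `|x| <= (1 + e^-1) * gexp e x.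
Proof.
move=> e0; have e1 : 0 < e^-1 by rewrite invr_gt0.
apply: (@le_trans _ _ (1 + x ^+ 2)).
  have : 0 <= (`|x| - 1) ^+ 2 by exact: sqr_ge0.
  have -> : x ^+ 2 = `|x| ^+ 2 by rewrite real_normK ?num_real.
  have := normr_ge0 x; nra.
apply: (@le_trans _ _ ((1 + e^-1) * (1 + e * x ^+ 2))); last first.
  by rewrite ler_wpM2l ?expR_ge1Dx//; lra.
have -> : (1 + e^-1) * (1 + e * x ^+ 2) = 1 + e^-1 + e * x ^+ 2 + x ^+ 2.
  by field; rewrite gt_eqF.
have := sqr_ge0 x; nra.
Qed.

(** The variables [v] and [x] may be dependent; the bound separates them, so that
    expectations only involve the two marginal laws. *)
Lemma normrM_gexp_le l l' x v : 0 <= l -> l < l' ->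
  `|v| * gexp l x <= (1 + (l' - l)^-1) * (gexp l' v + gexp l' x).
Proof.
move=> l0 ll'; have e0 : 0 < l' - l by rewrite subr_gt0.
have c0 : 0 <= 1 + (l' - l)^-1 by rewrite addr_ge0// invr_ge0 ltW.
apply: (@le_trans _ _ ((1 + (l' - l)^-1) * (gexp (l' - l) v * gexp l x))).
  by rewrite mulrA ler_wpM2r ?gexp_ge0// normr_le_gexp.
rewrite ler_wpM2l// /gexp -expRD.
have [xv|vx] := leP (x ^+ 2) (v ^+ 2).
  apply: le_trans (_ : expR (l' * v ^+ 2) <= _); last by rewrite lerDl expR_ge0.
  rewrite ler_expR; nra.
apply: le_trans (_ : expR (l' * x ^+ 2) <= _); last by rewrite lerDr expR_ge0.
rewrite ler_expR; nra.
Qed.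

(** The convexity inequality [expR z >= 1 + z] at [z = x - y], for [x <= y]. *)
Lemma expR_local_lipschitz x y :
  `|expR x - expR y| <= `|x - y| * (expR x + expR y).
Proof.
wlog xy : x y / x <= y => [H|].
  have [|/ltW] := leP x y; first exact: H.
  by move=> /H; rewrite distrC (distrC y) (addrC (expR y)).
rewrite distrC (distrC x) !ger0_norm ?subr_ge0 ?ler_expR//.
have -> : expR x = expR y * expR (x - y) by rewrite -expRD addrC subrK.
apply: (@le_trans _ _ ((y - x) * expR y)).
  have := expR_ge1Dx (x - y); have := expR_ge0 y; nra.
by rewrite ler_wpM2l ?subr_ge0// lerDr mulr_ge0// expR_ge0.
Qed.

Lemma gexp_local_lipschitz l l' x y : 0 <= l -> l < l' ->
  `|gexp l x - gexp l y| <=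
    4 * l * (1 + (l' - l)^-1) * (`|x - y| * (gexp l' x + gexp l' y)).
Proof.
move=> l0 ll'; apply: (le_trans (expR_local_lipschitz _ _)).
rewrite -/(gexp l x) -/(gexp l y).
have -> : l * x ^+ 2 - l * y ^+ 2 = l * ((x - y) * (x + y)) by ring.
rewrite !normrM (ger0_norm l0).
set c := 1 + _.
have -> : 4 * l * c * (`|x - y| * (gexp l' x + gexp l' y)) =
  l * `|x - y| * (4 * c * (gexp l' x + gexp l' y)) by ring.
have -> : l * (`|x - y| * `|x + y|) * (gexp l x + gexp l y) =
  l * `|x - y| * (`|x + y| * (gexp l x + gexp l y)) by ring.
rewrite ler_wpM2l ?mulr_ge0//.
apply: (@le_trans _ _ ((`|x| + `|y|) * (gexp l x + gexp l y))).
  by rewrite ler_wpM2r ?addr_ge0 ?gexp_ge0// ler_normD.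
have := normrM_gexp_le x x l0 ll'; have := normrM_gexp_le x y l0 ll'.
have := normrM_gexp_le y x l0 ll'; have := normrM_gexp_le y y l0 ll'.
rewrite -/c; lra.
Qed.

(** The exponent of the constant is the maximum of [l (x + t)^2 - l' x^2] over all
    [x] and [|t| <= 1]. *)
Lemma gexp_near l l' x y : 0 <= l -> l < l' -> `|x - y| <= 1 ->
  gexp l y <= expR (l * (1 + l / (l' - l))) * gexp l' x.
Proof.
move=> l0 ll' xy1; rewrite /gexp -expRD ler_expR.
have e0 : 0 < l' - l by rewrite subr_gt0.
set t := y - x; have yE : y = x + t by rewrite /t addrC subrK.
have t1 : t ^+ 2 <= 1.
  move: xy1; rewrite distrC -/t ler_norml => /andP[t1 t2]; nra.
have -> : l' = l + (l' - l) by rewrite addrC subrK.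
move: e0; move: (l' - l) => e e0 {ll'}.
have -> : l + e - l = e by ring.
rewrite yE; set q := l / e; have lE : l = q * e by rewrite /q divfK// gt_eqF.
have q0 : 0 <= q by rewrite /q divr_ge0// ltW.
rewrite lE.
(* with [e = l' - l] and [q = l / e], the two sides differ by the sum of these two
   nonnegative terms *)
have : 0 <= e * (x - q * t) ^+ 2 by rewrite mulr_ge0 ?sqr_ge0// ltW.
have : 0 <= e * q * (1 + q) * (1 - t ^+ 2).
  rewrite mulr_ge0 ?subr_ge0// mulr_ge0 ?addr_ge0// mulr_ge0//.
  exact: ltW.
have -> : e * q * (1 + q) * (1 - t ^+ 2) = e*q + e*q^+2 - e*q*t^+2 - e*q^+2*t^+2 by ring.
have -> : e * (x - q * t) ^+ 2 = e*x^+2 - 2*(e*q*x*t) + e*q^+2*t^+2 by ring.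
have -> : q * e * (1 + q) + (q * e + e) * x ^+ 2 = q*e + e*q^+2 + q*e*x^+2 + e*x^+2 by ring.
have -> : q * e * (x + t) ^+ 2 = q*e*x^+2 + 2*(e*q*x*t) + e*q*t^+2 by ring.
lra.
Qed.

End gaussian_weight.

(** The local Lipschitz bound turns a small displacement of the argument into a
    small error in mean, with a rate; its constant is allowed to grow like the
    function itself, so that [gexp] is included. *)
Definition tame {R : realType} (l : R) (G : R -> R) : Prop :=
  measurable_fun setT G /\ exists2 C, 0 <= C &
    (forall x, `|G x| <= C * gexp l x) /\
    (forall x y, `|G x - G y| <= C * (`|x - y| * (gexp l x + gexp l y))).

Section tame_functions.
Context {R : realType}.
Implicit Types (l : R) (G : R -> R).

Lemma tame_gexp l l' : 0 <= l -> l < l' -> tame l' (gexp l).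
Proof.
move=> l0 ll'; split; first exact: measurable_gexp.
have e0 : 0 < l' - l by rewrite subr_gt0.
have c0 : 0 <= 4 * l * (1 + (l' - l)^-1).
  by rewrite !mulr_ge0// addr_ge0// invr_ge0 ltW.
exists (1 + 4 * l * (1 + (l' - l)^-1)); first by rewrite addr_ge0.
split=> [x|x y].
  rewrite ger0_norm ?gexp_ge0//.
  apply: (le_trans (ler_gexp x (ltW ll'))).
  by rewrite ler_peMl ?gexp_ge0// lerDl.
apply: (le_trans (gexp_local_lipschitz x y l0 ll')).
by rewrite ler_wpM2r ?lerDr// mulr_ge0// addr_ge0 ?gexp_ge0.
Qed.

Lemma tameD l G1 G2 : tame l G1 -> tame l G2 -> tame l (G1 \+ G2).
Proof.
move=> [m1 [C1 C10 [b1 h1]]] [m2 [C2 C20 [b2 h2]]].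
split; first exact: measurable_funD.
exists (C1 + C2); first by rewrite addr_ge0.
split=> [x|x y] /=; rewrite mulrDl.
  by apply: (le_trans (ler_normD _ _)); rewrite lerD.
rewrite opprD addrACA; by apply: (le_trans (ler_normD _ _)); rewrite lerD.
Qed.

Lemma tame_norm l G : tame l G -> tame l (fun x => `|G x|).
Proof.
move=> [m1 [C C0 [b1 h1]]]; split; first exact: measurableT_comp.
exists C => //; split=> [x|x y]; first by rewrite normr_id.
exact: (le_trans (ler_dist_dist _ _)).
Qed.

End tame_functions.

(** * Integrals of functions of standard normal and independent variables *)

Section normal_integral.
Context {R : realType}.
Local Notation mu := lebesgue_measure.
Local Notation N01 := (@normal_prob R 0 1).

(** The density of [normal_prob] is its Radon-Nikodym derivative, by almost
    everywhere uniqueness of the latter. *)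
Lemma ge0_integral_normal_prob (f : R -> R) :
  measurable_fun setT f -> (forall x, 0 <= f x) ->
  (\int[N01]_x (f x)%:E = \int[mu]_x ((f x)%:E * (normal_pdf 0 1 x)%:E))%E.
Proof.
move=> mf f0.
have dom := @normal_prob_dominates R 0 1.
rewrite -(Radon_Nikodym_SigmaFinite.change_of_variables dom)//; last first.
  exact/measurable_EFinP.
have mpdf : measurable_fun setT (fun x => (@normal_pdf R 0 1 x)%:E).
  by apply/measurable_EFinP; exact: measurable_normal_pdf.
apply: ae_eq_integral => //.
- apply: emeasurable_funM; first exact/measurable_EFinP.
  apply: measurable_int; exact: Radon_Nikodym_SigmaFinite.f_integrable.
- by apply: emeasurable_funM => //; exact/measurable_EFinP.
- apply: ae_eqe_mul2l; apply: integral_ae_eq => //.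
    exact: Radon_Nikodym_SigmaFinite.f_integrable.
  by move=> E _ mE; rewrite -Radon_Nikodym_SigmaFinite.f_integral.
Qed.

(** [gexp l] against the standard normal density is, up to a constant, the
    normal density of variance [1 / (1 - 2 l)]. *)
Lemma integrable_gexp (l : R) : l < 1 / 2 ->
  N01.-integrable setT (EFin \o gexp l).
Proof.
move=> l2; apply/integrableP; split.
  by apply/measurable_EFinP; exact: measurable_gexp.
under eq_integral do rewrite /= ger0_norm ?gexp_ge0//.
rewrite ge0_integral_normal_prob//; last 2 first.
- exact: measurable_gexp.
- by move=> x; exact: gexp_ge0.
have v0 : 0 < 1 - 2 * l by lra.
pose s := (Num.sqrt (1 - 2 * l))^-1.
have s0 : 0 < s by rewrite invr_gt0 sqrtr_gt0.
have s2 : s ^+ 2 = (1 - 2 * l)^-1 by rewrite exprVn sqr_sqrtr// ltW.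
have c0 : 0 < @normal_peak R s by exact/normal_peak_gt0/lt0r_neq0.
under eq_integral => x _.
  have -> : ((gexp l x)%:E * (normal_pdf 0 1 x)%:E =
    (normal_peak 1 / normal_peak s)%:E * (normal_pdf 0 s x)%:E)%E.
    rewrite -!EFinM !normal_pdfE ?oner_neq0 ?lt0r_neq0//; congr EFin.
    rewrite /gexp /normal_fun s2 expr1n !subr0.
    rewrite mulrCA -expRD [RHS]mulrA divfK ?lt0r_neq0//; congr (_ * expR _).
    by field; rewrite lt0r_neq0.
  over.
rewrite ge0_integralZl//; last 3 first.
- by apply/measurable_EFinP; exact: measurable_normal_pdf.
- by move=> x _; rewrite lee_fin normal_pdf_ge0.
- by rewrite lee_fin divr_ge0 ?normal_peak_ge0.
by rewrite integral_normal_pdf mule1 ltry.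
Qed.

Lemma tame_measurable (l : R) G : tame l G -> measurable_fun setT G.
Proof. by case. Qed.

Lemma integrable_tame (l : R) G : l < 1 / 2 -> tame l G ->
  N01.-integrable setT (EFin \o G).
Proof.
move=> l2 [mG [C C0 [leG _]]].
apply: (le_integrable measurableT _ _ (integrableZl measurableT C (integrable_gexp l2))).
  exact/measurable_EFinP.
move=> x _ /=; rewrite lee_fin (ger0_norm (mulr_ge0 _ (gexp_ge0 _ _)))//.
Qed.

End normal_integral.

Section law.
Context {R : realType} {d : measure_display} {Omega : measurableType d}.
Variable P : probability Omega R.
Local Notation N01 := (@normal_prob R 0 1).

Lemma normal_integral_comp (X : Omega -> R) (u : R -> R) :
  measurable_fun setT X -> normally_distributed P X 0 1 ->
  measurable_fun setT u -> N01.-integrable setT (EFin \o u) ->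
  P.-integrable setT (EFin \o (u \o X)) /\
  (\int[P]_w (u (X w))%:E = \int[N01]_x (u x)%:E)%E.
Proof.
move=> mX nX mu /integrableP[_ iu].
have meu : measurable_fun setT (EFin \o u : measurableTypeR R -> \bar R).
  exact/measurable_EFinP.
have i : P.-integrable setT ((EFin \o u) \o X).
  apply/integrableP; split; first exact: measurableT_comp.
  move: iu; apply: le_lt_trans.
  rewrite -[leLHS](@ge0_integral_pushforward _ _ _ _ _
    (X : Omega -> measurableTypeR R) mX P setT (abse \o (EFin \o u)))//=.
  - rewrite le_eqVlt; apply/orP; left; apply/eqP.
    by apply: eq_measure_integral => A mA _; exact: nX.
  - exact: measurableT_comp.
split => //.
rewrite -(@integral_pushforward _ _ _ _ _
  (X : Omega -> measurableTypeR R) mX P setT (EFin \o u))//.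
by apply: eq_measure_integral => A mA _; exact: nX.
Qed.

Definition independent_pair (X Y : Omega -> R) : Prop :=
  forall A B : set R, measurable A -> measurable B ->
    P (X @^-1` A `&` Y @^-1` B) = (P (X @^-1` A) * P (Y @^-1` B))%E.

Lemma independent_pair_comp (X Y : Omega -> R) (u v : R -> R) :
  measurable_fun setT u -> measurable_fun setT v ->
  independent_pair X Y -> independent_pair (u \o X) (v \o Y).
Proof.
move=> mu mv XY A B mA mB.
apply: (XY (u @^-1` A) (v @^-1` B)).
  by rewrite -[X in measurable X]setTI; exact: mu.
by rewrite -[X in measurable X]setTI; exact: mv.
Qed.

Lemma bounded_integrable (X : Omega -> R) (B : R) :
  measurable_fun setT X -> (forall w, `|X w| <= B) ->
  P.-integrable setT (EFin \o X).
Proof.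
move=> mX bX; apply: measurable_bounded_integrable => //.
  by rewrite (le_lt_trans (probability_le1 _ _))// ltry.
by exists B; split; [exact: num_real|move=> x Bx w _; exact: le_trans (bX w) (ltW Bx)].
Qed.

(** The joint law is the product of the marginals, so Fubini applies. *)
Lemma independent_pair_Rintegral (X Y : Omega -> R) (B : R) :
  measurable_fun setT X -> measurable_fun setT Y ->
  (forall w, `|X w| <= B) -> (forall w, `|Y w| <= B) ->
  independent_pair X Y ->
  \int[P]_w (X w * Y w) = \int[P]_w X w * \int[P]_w Y w.
Proof.
move=> mX mY bX bY XY.
have iX := bounded_integrable mX bX; have iY := bounded_integrable mY bY.
have mXY : measurable_fun setT (fun w => X w * Y w) by exact: measurable_funM.
have bXY w : `|X w * Y w| <= B * B by rewrite normrM ler_pM.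
have iXY := bounded_integrable mXY bXY.
pose X' : {mfun Omega >-> R} := HB.pack X (isMeasurableFun.Build _ _ _ _ X mX).
pose Y' : {mfun Omega >-> R} := HB.pack Y (isMeasurableFun.Build _ _ _ _ Y mY).
have mT : measurable_fun setT (fun w => (X w, Y w)) by exact: measurable_fun_pair.
pose f (z : R * R) : \bar R := (z.1 * z.2)%:E.
have mf : measurable_fun setT f.
  apply/measurable_EFinP; apply: measurable_funM.
    exact: measurable_fst.
  exact: measurable_snd.
pose m1 := distribution P X'. pose m2 := distribution P Y'.
have prodE : (\int[P]_w (X w * Y w)%:E = \int[m1 \x m2]_z f z)%E.
  transitivity (\int[pushforward P (fun w => (X w, Y w))]_z f z)%E.
    by rewrite (integral_pushforward mT mf).
  apply: eq_measure_integral => A mA _; apply/esym.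
  by apply: (@product_measure_unique _ _ R R R m1 m2).
have iX' : m1.-integrable setT (EFin \o id).
  by apply: (integrable_pushforward mX) => //; exact/measurable_EFinP.
have iY' : m2.-integrable setT (EFin \o id).
  by apply: (integrable_pushforward mY) => //; exact/measurable_EFinP.
have EX : (\int[m1]_x x%:E = \int[P]_w (X w)%:E)%E.
  by rewrite (integral_pushforward mX).
have EY : (\int[m2]_x x%:E = \int[P]_w (Y w)%:E)%E.
  by rewrite (integral_pushforward mY).
have iprod : (m1 \x m2)%E.-integrable setT f.
  apply/integrable12ltyP => //=.
  under eq_integral => x _.
    under eq_integral do rewrite normrM EFinM.
    rewrite ge0_integralZl//; last first.
      by apply/measurable_EFinP; exact: normr_measurable.
    over.
  rewrite ge0_integralZr//; last 2 first.
  - by apply/measurable_EFinP; exact: normr_measurable.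
  - exact: integral_ge0.
  case/integrableP : iX' => _; case/integrableP : iY' => _ /= h1 h2.
  apply: lte_mul_pinfty => //; first exact: integral_ge0.
  by rewrite ge0_fin_numE//; exact: integral_ge0.
rewrite /Rintegral prodE -integral12_prod_meas1//= -fineM; last 2 first.
- exact: integrable_fin_num.
- exact: integrable_fin_num.
congr fine; rewrite -EX -EY.
under eq_integral => x _.
  rewrite /fubini_F; under eq_integral do rewrite /f/= EFinM.
  rewrite integralZl//.
  over.
rewrite /=.
rewrite -[in LHS](fineK (integrable_fin_num measurableT iY')).
rewrite integralZr// fineK//.
exact: (integrable_fin_num measurableT iY').
Qed.

End law.

(** * A mean bound for weighted sums of nearly independent normal variables *)

Section Rintegral_extra.
Context {R : realType} {d : measure_display} {T : measurableType d}.
Variable mu : {measure set T -> \bar R}.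

Lemma integrableD_fun (f g : T -> R) :
  mu.-integrable setT (EFin \o f) -> mu.-integrable setT (EFin \o g) ->
  mu.-integrable setT (EFin \o (fun x => f x + g x)).
Proof. by move=> If Ig; have := integrableD measurableT If Ig. Qed.

Lemma integrableZl_fun (c : R) (f : T -> R) :
  mu.-integrable setT (EFin \o f) ->
  mu.-integrable setT (EFin \o (fun x => c * f x)).
Proof. by move=> If; have := integrableZl measurableT c If. Qed.

Lemma integrable_sum_fun n (f : 'I_n -> T -> R) :
  (forall i, mu.-integrable setT (EFin \o f i)) ->
  mu.-integrable setT (EFin \o (fun x => \sum_(i < n) f i x)).
Proof.
move=> If; have := @integrable_sum _ _ _ mu setT measurableT _
  (index_enum 'I_n) xpredT (fun i => EFin \o f i) (fun i _ => If i).
by apply: eq_integrable => // x _ /=; rewrite sumEFin.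
Qed.

Lemma Rintegral_sum n (f : 'I_n -> T -> R) :
  (forall i, mu.-integrable setT (EFin \o f i)) ->
  \int[mu]_x (\sum_(i < n) f i x) = \sum_(i < n) \int[mu]_x f i x.
Proof.
move=> If; apply: EFin_inj; rewrite /Rintegral fineK; last first.
  exact: (integrable_fin_num measurableT (integrable_sum_fun If)).
under eq_integral do rewrite -sumEFin.
rewrite integral_sum//= -sumEFin; apply: eq_bigr => i _.
by rewrite fineK//; exact: (integrable_fin_num measurableT (If i)).
Qed.

Lemma le_integrable_fun (f g : T -> R) : measurable_fun setT f ->
  (forall x, `|f x| <= g x) -> mu.-integrable setT (EFin \o g) ->
  mu.-integrable setT (EFin \o f).
Proof.
move=> mf fg; apply: le_integrable => //; first exact/measurable_EFinP.
by move=> x _ /=; rewrite lee_fin (le_trans (fg x))// ler_norm.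
Qed.

End Rintegral_extra.

Lemma Rintegral_prob_cst {R : realType} {d : measure_display}
  {T : measurableType d} (P : probability T R) (c : R) : \int[P]_x c = c.
Proof.
rewrite Rintegral_cst// -[RHS]mulr1; congr (_ * _).
by have /(congr1 fine) := probability_setT P.
Qed.

Section weighted_sums.
Context {R : realType} {dd : measure_display} {Omega : measurableType dd}.
Variable P : probability Omega R.
Local Notation N01 := (@normal_prob R 0 1).

Definition std_normal (X : Omega -> R) : Prop :=
  measurable_fun setT X /\ normally_distributed P X 0 1.

Lemma std_normal_integrable (X : Omega -> R) (u : R -> R) :
  std_normal X -> measurable_fun setT u -> N01.-integrable setT (EFin \o u) ->
  P.-integrable setT (EFin \o (fun w => u (X w))).
Proof. by move=> [mX nX] mu iu; have [] := normal_integral_comp mX nX mu iu. Qed.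

Lemma std_normal_Rintegral (X : Omega -> R) (u : R -> R) :
  std_normal X -> measurable_fun setT u -> N01.-integrable setT (EFin \o u) ->
  \int[P]_w u (X w) = \int[N01]_x u x.
Proof.
move=> [mX nX] mu iu; have [_ e] := normal_integral_comp mX nX mu iu.
by rewrite /Rintegral e.
Qed.

Variables (n : nat) (a : nat -> R).
Hypothesis a_ge0 : forall k, 0 <= a k.

(** After expanding the square, pairs of far apart indices vanish, and each index
    has companions of total weight at most [D], each pair contributing at most
    [B ^+ 2]. *)
Lemma weighted_sum_second_moment (U : nat -> Omega -> R)
    (far : nat -> nat -> bool) (B D : R) :
  (forall k, measurable_fun setT (U k)) -> (forall k w, `|U k w| <= B) ->
  (forall j k, (j < n)%N -> (k < n)%N -> far j k ->
    \int[P]_w (U j w * U k w) = 0) ->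
  (forall k, (k < n)%N -> \sum_(j < n | ~~ far j k) a j <= D) ->
  \int[P]_w (\sum_(k < n) a k * U k w) ^+ 2 <=
    B ^+ 2 * D * \sum_(k < n) a k.
Proof.
move=> mU bU farU sumD.
have mUU j k : measurable_fun setT (fun w => U j w * U k w).
  exact: measurable_funM.
have bUU j k w : `|U j w * U k w| <= B ^+ 2.
  by rewrite normrM expr2 ler_pM.
have iUU j k := bounded_integrable P (mUU j k) (bUU j k).
have iaU j k : P.-integrable setT
    (EFin \o (fun w => a k * (a j * (U j w * U k w)))).
  by apply: integrableZl_fun; exact: integrableZl_fun.
have UUle j k : \int[P]_w (U j w * U k w) <= B ^+ 2.
  rewrite -(Rintegral_prob_cst P (B ^+ 2)); apply: le_Rintegral => //.
    apply: (@bounded_integrable _ _ _ _ _ (B ^+ 2)) => // w.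
    by rewrite ger0_norm ?sqr_ge0.
  by move=> w _; exact: le_trans (ler_norm _) (bUU j k w).
have sq w : (\sum_(k < n) a k * U k w) ^+ 2 =
    \sum_(k < n) \sum_(j < n) a k * (a j * (U j w * U k w)).
  rewrite expr2 mulr_sumr; apply: eq_bigr => k _.
  rewrite mulr_suml; apply: eq_bigr => j _; ring.
under eq_Rintegral do rewrite sq.
rewrite Rintegral_sum; last by move=> k; apply: integrable_sum_fun => j.
rewrite mulr_sumr; apply: ler_sum => k _.
rewrite Rintegral_sum//.
apply: (@le_trans _ _ (\sum_(j < n) if ~~ far j k then a k * a j * B ^+ 2 else 0)).
  apply: ler_sum => j _; rewrite RintegralZl//; last exact: integrableZl_fun.
  rewrite RintegralZl//; have [fjk|nfjk] /= := boolP (far j k).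
    by rewrite farU// !mulr0.
  by rewrite mulrA ler_wpM2l ?mulr_ge0.
rewrite -big_mkcond/= (_ : B ^+ 2 * D * a k = B ^+ 2 * a k * D); last by ring.
apply: (@le_trans _ _ (B ^+ 2 * a k * \sum_(j < n | ~~ far j k) a j)).
  by rewrite mulr_sumr; apply: ler_sum => j _; rewrite le_eqVlt; apply/orP;
    left; apply/eqP; ring.
by apply: ler_wpM2l; [rewrite mulr_ge0 ?sqr_ge0|exact/sumD/ltn_ord].
Qed.


(** Cutting in the argument rather than in the value makes both the bound on the
    truncation and the error exponential in [kappa]. *)
Definition truncate (kappa : R) (G : R -> R) (x : R) : R :=
  if x ^+ 2 <= kappa then G x else 0.

Lemma measurable_truncate kappa G : measurable_fun setT G ->
  measurable_fun setT (truncate kappa G).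
Proof.
move=> mG; apply: measurable_fun_ifT => //.
by apply: measurable_fun_ler => //; exact: measurable_funX.
Qed.

Lemma truncate_le (kappa l C : R) (G : R -> R) (x : R) : 0 <= l -> 0 <= C ->
  (forall y, `|G y| <= C * gexp l y) ->
  `|truncate kappa G x| <= C * expR (l * kappa).
Proof.
move=> l0 C0 leG; rewrite /truncate; case: ifPn => [xk|_]; last first.
  by rewrite normr0 mulr_ge0// expR_ge0.
by apply: (le_trans (leG x)); rewrite ler_wpM2l// ler_expR ler_wpM2l.
Qed.

Lemma truncate_error (kappa l l' C : R) (G : R -> R) (x : R) : l <= l' -> 0 <= C ->
  (forall y, `|G y| <= C * gexp l y) ->
  `|G x - truncate kappa G x| <= C * expR (- ((l' - l) * kappa)) * gexp l' x.
Proof.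
move=> ll' C0 leG; rewrite /truncate; case: ifPn => [xk|].
  by rewrite subrr normr0 !mulr_ge0// expR_ge0.
rewrite -ltNge subr0 => kx; apply: (le_trans (leG x)).
rewrite -mulrA ler_wpM2l// /gexp -expRD ler_expR; nra.
Qed.

(** The expectation involves products such as [`|V| * gexp l X] of dependent
    variables, which [normrM_gexp_le] reduces to the standard normal law. *)
Lemma std_normal_replacement (l l' C eta : R) (G : R -> R)
    (X V Z : Omega -> R) :
  0 <= l -> l < l' -> l' < 1 / 2 -> 0 <= C -> 0 <= eta ->
  measurable_fun setT G ->
  (forall x y, `|G x - G y| <= C * (`|x - y| * (gexp l x + gexp l y))) ->
  std_normal X -> std_normal V -> std_normal Z ->
  (forall w, `|X w - Z w| <= eta * (`|V w| + `|Z w|)) ->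
  P.-integrable setT (EFin \o (fun w => `|G (X w) - G (Z w)|)) /\
  \int[P]_w `|G (X w) - G (Z w)| <=
    C * eta * (8 * (1 + (l' - l)^-1) * \int[N01]_x gexp l' x).
Proof.
move=> l0 ll' l'2 C0 eta0 mG lipG nX nV nZ XZ.
set c := 1 + (l' - l)^-1.
have ig := integrable_gexp l'2.
have mg := @measurable_gexp R l'.
have iY Y : std_normal Y -> P.-integrable setT (EFin \o (fun w => gexp l' (Y w))).
  by move=> nY; exact: std_normal_integrable.
pose F w := C * eta * (2 * c) *
  (gexp l' (X w) + (gexp l' (V w) + 2 * gexp l' (Z w))).
have iF : P.-integrable setT (EFin \o F).
  apply: integrableZl_fun; apply: integrableD_fun; first exact: iY.
  by apply: integrableD_fun; [exact: iY|apply: integrableZl_fun; exact: iY].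
have leF w : `|G (X w) - G (Z w)| <= F w.
  apply: (le_trans (lipG _ _)); rewrite /F -!(mulrA C) ler_wpM2l//.
  apply: (@le_trans _ _ (eta * (`|V w| + `|Z w|) *
      (gexp l (X w) + gexp l (Z w)))).
    by rewrite ler_wpM2r ?addr_ge0 ?gexp_ge0.
  rewrite -!(mulrA eta) ler_wpM2l//.
  have := normrM_gexp_le (X w) (V w) l0 ll'.
  have := normrM_gexp_le (Z w) (V w) l0 ll'.
  have := normrM_gexp_le (X w) (Z w) l0 ll'.
  have := normrM_gexp_le (Z w) (Z w) l0 ll'.
  rewrite -/c; lra.
have mXZ : measurable_fun setT (fun w => `|G (X w) - G (Z w)|).
  case: nX => mX _; case: nZ => mZ _.
  apply: measurableT_comp; first exact: normr_measurable.
  by apply: measurable_funB; exact: measurableT_comp.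
have iXZ : P.-integrable setT (EFin \o (fun w => `|G (X w) - G (Z w)|)).
  by apply: (le_integrable_fun mXZ _ iF) => w; rewrite normr_id.
split => //; apply: (le_trans (le_Rintegral measurableT iXZ iF (fun w _ => leF w))).
rewrite /F RintegralZl//; last first.
  apply: integrableD_fun; first exact: iY.
  by apply: integrableD_fun; [exact: iY|apply: integrableZl_fun; exact: iY].
rewrite RintegralD//; [|exact: iY|]; last first.
  by apply: integrableD_fun; [exact: iY|apply: integrableZl_fun; exact: iY].
rewrite RintegralD//; [|exact: iY|by apply: integrableZl_fun; exact: iY].
rewrite RintegralZl//; last exact: iY.
rewrite !(std_normal_Rintegral _ mg)//.
by rewrite le_eqVlt; apply/orP; left; apply/eqP; ring.
Qed.

End weighted_sums.

Section L1_bound.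
Context {R : realType} {dd : measure_display} {Omega : measurableType dd}.
Variable P : probability Omega R.
Local Notation N01 := (@normal_prob R 0 1).

(** Young's inequality in the form [2 |s| <= s^2 / c + c], integrated; it plays
    the role of the Cauchy-Schwarz inequality, with [c] chosen by the caller. *)
Lemma Rintegral_norm_le (s : Omega -> R) (c : R) : 0 < c ->
  P.-integrable setT (EFin \o (fun w => `|s w|)) ->
  P.-integrable setT (EFin \o (fun w => s w ^+ 2)) ->
  \int[P]_w `|s w| <= 2^-1 * (c^-1 * (\int[P]_w s w ^+ 2) + c).
Proof.
move=> c0 is1 is2.
have ic : P.-integrable setT (EFin \o (fun=> c)).
  by apply: (@bounded_integrable _ _ _ _ _ `|c|).
have iF : P.-integrable setT (EFin \o (fun w => 2^-1 * (c^-1 * s w ^+ 2 + c))).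
  apply/integrableZl_fun/integrableD_fun => //; exact: integrableZl_fun.
have le w : `|s w| <= 2^-1 * (c^-1 * s w ^+ 2 + c).
  have -> : s w ^+ 2 = `|s w| ^+ 2 by rewrite real_normK ?num_real.
  have : 0 <= c^-1 * (`|s w| - c) ^+ 2 by rewrite mulr_ge0 ?sqr_ge0// invr_ge0 ltW.
  have -> : c^-1 * (`|s w| - c) ^+ 2 = c^-1 * `|s w| ^+ 2 - 2 * `|s w| + c.
    by field; rewrite gt_eqF.
  lra.
apply: (le_trans (le_Rintegral measurableT is1 iF (fun w _ => le w))).
rewrite RintegralZl//; last by apply: integrableD_fun => //; exact: integrableZl_fun.
rewrite RintegralD//; last exact: integrableZl_fun.
by rewrite RintegralZl// Rintegral_prob_cst.
Qed.

(** The sum is split into the replacement error [X - Z], the truncation error and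
    the centred truncated sum.  The first is of order [expR (- kappa / 2)], the
    second of order [expR (- (l' - l) * kappa)].  The third has second moment at
    most of order [expR (2 * l * kappa) * kappa] times the total weight, where
    [2 * l < 1]: this is what the lower bound on the total weight beats. *)
Lemma weighted_sum_L1 (l l' : R) (G : R -> R) :
  0 <= l -> l < l' -> l' < 1 / 2 -> tame l G ->
  exists2 C, 0 <= C &
  forall (kappa : R) (n : nat) (a : nat -> R) (X V Z : nat -> Omega -> R)
    (far : nat -> nat -> bool),
  0 <= kappa -> (forall k, 0 <= a k) ->
  (forall k, std_normal P (X k)) -> (forall k, std_normal P (V k)) ->
  (forall k, std_normal P (Z k)) ->
  (forall k w, `|X k w - Z k w| <= expR (- (kappa / 2)) * (`|V k w| + `|Z k w|)) ->
  (forall j k, far j k -> independent_pair P (Z j) (Z k)) ->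
  (forall k, (k < n)%N -> \sum_(j < n | ~~ far j k) a j <= 3 + 2 * kappa) ->
  expR (4 * kappa) <= \sum_(k < n) a k ->
  let D w := \sum_(k < n) a k * (G (X k w) - \int[N01]_x G x) in
  P.-integrable setT (EFin \o (fun w => `|D w|)) /\
  \int[P]_w `|D w| <=
    C * (\sum_(k < n) a k) * expR (- ((l' - l) * kappa)).
Proof.
move=> l0 ll' l'2 tG; have [mG [C C0 [leG lipG]]] := tG.
have l2 : l < 1 / 2 by lra.
have iG := integrable_tame l2 tG.
set c := 1 + (l' - l)^-1.
set I := \int[N01]_x gexp l' x.
have c0 : 0 <= c by rewrite addr_ge0// invr_ge0 subr_ge0 ltW.
have I0 : 0 <= I by apply: Rintegral_ge0 => x _; exact: gexp_ge0.
exists (C * (8 * c * I) + 2 * (C * I) + (6 * C ^+ 2 + 2^-1)).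
  have CI0 : 0 <= C * I by exact: mulr_ge0.
  have C20 : 0 <= C ^+ 2 by exact: sqr_ge0.
  rewrite !addr_ge0//; [|exact: mulr_ge0|exact: mulr_ge0].
  by rewrite mulr_ge0// mulr_ge0// mulr_ge0.
move=> kappa n a X V Z far k0 a0 nX nV nZ XZ indZ sumfar Lambda_ge /=.
set Lambda := \sum_(k < n) a k.
set m := \int[N01]_x G x.
have L0 : 0 < Lambda by exact: lt_le_trans (expR_gt0 _) Lambda_ge.
pose T := truncate kappa G.
have mT : measurable_fun setT T by exact: measurable_truncate.
pose B0 := C * expR (l * kappa).
have bT x : `|T x| <= B0 by exact: truncate_le.
have B00 : 0 <= B0 by rewrite mulr_ge0// expR_ge0.
have iT : N01.-integrable setT (EFin \o T).
  exact: (@bounded_integrable _ _ _ N01 T B0).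
pose mK := \int[N01]_x T x.
pose er := C * expR (- ((l' - l) * kappa)).
have er0 : 0 <= er by rewrite mulr_ge0// expR_ge0.
have Rle x : `|G x - T x| <= er * gexp l' x.
  exact: (truncate_error kappa x (ltW ll') C0 leG).
have ig := integrable_gexp l'2.
have mg := @measurable_gexp R l'.
have iR : N01.-integrable setT (EFin \o (fun x => er * gexp l' x)).
  exact: integrableZl_fun.
have mGT : measurable_fun setT (fun x => `|G x - T x|).
  by apply: measurableT_comp; [exact: normr_measurable|exact: measurable_funB].
have iGT : N01.-integrable setT (EFin \o (fun x => `|G x - T x|)).
  by apply: (@le_integrable_fun R _ (measurableTypeR R) N01 _ _ mGT _ iR) => x; rewrite normr_id.
have IGT : \int[N01]_x `|G x - T x| <= er * I.
  by rewrite -RintegralZl//; apply: le_Rintegral.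
have mmK : `|m - mK| <= er * I.
  apply: le_trans IGT; rewrite /m /mK -RintegralB//.
  apply: le_normr_Rintegral => //.
  by have := integrableB measurableT iG iT.
pose U k w := T (Z k w) - mK.
have bmK : `|mK| <= B0.
  have : N01.-integrable setT (EFin \o (fun x => `|T x|)).
    exact: integrable_norm.
  move=> inT; apply: (le_trans (le_normr_Rintegral measurableT iT)).
  rewrite -(Rintegral_prob_cst N01 B0); apply: le_Rintegral => //.
  exact: (@bounded_integrable _ _ _ _ _ `|B0|).
have bU k w : `|U k w| <= B0 + B0.
  by apply: (le_trans (ler_normB _ _)); rewrite lerD.
have mZ k : measurable_fun setT (Z k) by case: (nZ k).
have mX k : measurable_fun setT (X k) by case: (nX k).
have mU k : measurable_fun setT (U k).
  by apply: measurable_funB => //; exact: measurableT_comp.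
have EU k : \int[P]_w U k w = 0.
  rewrite RintegralB//; [|exact: std_normal_integrable|]; last first.
    exact: (@bounded_integrable _ _ _ _ _ `|mK|).
  rewrite (std_normal_Rintegral (nZ k) mT iT).
  by rewrite Rintegral_prob_cst subrr.
have farU j k : (j < n)%N -> (k < n)%N -> far j k ->
    \int[P]_w (U j w * U k w) = 0.
  move=> _ _ fjk; rewrite (independent_pair_Rintegral (mU j) (mU k) (bU j) (bU k)).
    by rewrite EU mul0r.
  have mTm : measurable_fun setT (fun x => T x - mK) by exact: measurable_funB.
  exact: (independent_pair_comp mTm mTm (indZ _ _ fjk)).
have S2 := weighted_sum_second_moment a0 mU bU farU sumfar.
pose s w := \sum_(k < n) a k * U k w.
pose D w := \sum_(k < n) a k * (G (X k w) - m).
pose F1 w := \sum_(k < n) a k * `|G (X k w) - G (Z k w)|.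
pose F3 w := \sum_(k < n) a k * (`|G (Z k w) - T (Z k w)| + er * I).
have mGX k : measurable_fun setT (fun w => G (X k w)) by exact: measurableT_comp.
have ms : measurable_fun setT s.
  apply: measurable_sum => k; apply: measurable_funM => //; exact: mU.
have mD : measurable_fun setT D.
  apply: measurable_sum => k; apply: measurable_funM => //.
  exact: measurable_funB.
have bs w : `|s w| <= Lambda * (B0 + B0).
  apply: (le_trans (ler_norm_sum _ _ _)); rewrite mulr_suml; apply: ler_sum => k _.
  by rewrite normrM (ger0_norm (a0 _)) ler_wpM2l.
have ins : P.-integrable setT (EFin \o (fun w => `|s w|)).
  by apply: integrable_norm => //; exact: bounded_integrable bs.
have is2 : P.-integrable setT (EFin \o (fun w => s w ^+ 2)).
  apply: (@bounded_integrable _ _ _ _ _ ((Lambda * (B0 + B0)) ^+ 2)).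
    exact: measurable_funX.
  move=> w; rewrite normrX; apply: lerXn2r; rewrite ?nnegrE//.
  exact: le_trans (bs w).
have eta0 : 0 <= expR (- (kappa / 2)) by exact: expR_ge0.
have repl k := std_normal_replacement l0 ll' l'2 C0 eta0 mG lipG
  (nX k) (nV k) (nZ k) (XZ k).
have iF1 : P.-integrable setT (EFin \o F1).
  apply: integrable_sum_fun => k; apply: integrableZl_fun.
  by case: (repl k).
have iGTZ k : P.-integrable setT (EFin \o (fun w => `|G (Z k w) - T (Z k w)|)).
  exact: (std_normal_integrable (nZ k) mGT iGT).
have ierI : P.-integrable setT (EFin \o (fun=> er * I)).
  exact: (@bounded_integrable _ _ _ _ _ `|er * I|).
have iF3 : P.-integrable setT (EFin \o F3).
  apply: integrable_sum_fun => k; apply: integrableZl_fun.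
  exact: integrableD_fun.
have leD w : `|D w| <= F1 w + (`|s w| + F3 w).
  have -> : D w = (\sum_(k < n) a k * (G (X k w) - G (Z k w))) +
      (s w + \sum_(k < n) a k * (G (Z k w) - T (Z k w) + (mK - m))).
    rewrite /D /s -!big_split/=; apply: eq_bigr => k _; rewrite /U; ring.
  apply: (le_trans (ler_normD _ _)); apply: lerD.
    apply: (le_trans (ler_norm_sum _ _ _)); apply: ler_sum => k _.
    by rewrite normrM (ger0_norm (a0 _)).
  apply: (le_trans (ler_normD _ _)); rewrite lerD2l.
  apply: (le_trans (ler_norm_sum _ _ _)); apply: ler_sum => k _.
  rewrite normrM (ger0_norm (a0 _)) ler_wpM2l//.
  by apply: (le_trans (ler_normD _ _)); rewrite lerD2l distrC.
have iF : P.-integrable setT (EFin \o (fun w => F1 w + (`|s w| + F3 w))).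
  by apply: integrableD_fun => //; exact: integrableD_fun.
have mnD : measurable_fun setT (fun w => `|D w|).
  by apply: measurableT_comp => //; exact: normr_measurable.
have iD : P.-integrable setT (EFin \o (fun w => `|D w|)).
  by apply: (le_integrable_fun mnD _ iF) => w; rewrite normr_id.
split => //.
apply: (le_trans (le_Rintegral measurableT iD iF (fun w _ => leD w))).
rewrite RintegralD//; last exact: integrableD_fun.
rewrite RintegralD//.
set eps := expR (- ((l' - l) * kappa)).
have eta_eps : expR (- (kappa / 2)) <= eps.
  rewrite ler_expR; nra.
have h1 : \int[P]_w F1 w <= Lambda * (C * (8 * c * I) * eps).
  rewrite Rintegral_sum; last by move=> k; apply: integrableZl_fun; case: (repl k).
  rewrite mulr_suml; apply: ler_sum => k _.
  rewrite RintegralZl//; last by case: (repl k).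
  rewrite ler_wpM2l//; case: (repl k) => _ /le_trans; apply.
  rewrite -/c -/I mulrAC ler_wpM2l// mulr_ge0// mulr_ge0// mulr_ge0//.
have h3 : \int[P]_w F3 w <= Lambda * (2 * (C * I) * eps).
  rewrite Rintegral_sum; last first.
    by move=> k; apply: integrableZl_fun; exact: integrableD_fun.
  rewrite mulr_suml; apply: ler_sum => k _.
  rewrite RintegralZl//; last exact: integrableD_fun.
  rewrite ler_wpM2l// RintegralD// Rintegral_prob_cst.
  rewrite (std_normal_Rintegral (nZ k) mGT iGT).
  have -> : 2 * (C * I) * eps = er * I + er * I by rewrite /er -/eps; ring.
  by rewrite lerD2r.
have h2 : \int[P]_w `|s w| <= Lambda * ((6 * C ^+ 2 + 2^-1) * eps).
  (* [Lambda * q] is the target size, hence the balance in Young's inequality *)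
  pose q := expR (- (kappa / 2)).
  have q0 : 0 < q by exact: expR_gt0.
  have c1 : 0 < Lambda * q by exact: mulr_gt0.
  apply: (le_trans (Rintegral_norm_le c1 ins is2)).
  have exps : expR (l * kappa * 2) * (3 + 2 * kappa) <= 3 * (Lambda * q * q).
    apply: (@le_trans _ _ (3 * (expR (l * kappa * 2) * expR (2 * kappa)))).
      rewrite mulrCA; apply: ler_wpM2l; first exact: expR_ge0.
      have := expR_ge1Dx (2 * kappa); lra.
    apply: ler_wpM2l => //.
    apply: (@le_trans _ _ (expR (4 * kappa) * q * q)); last first.
      by rewrite !ler_wpM2r// ltW.
    rewrite /q -!expRD ler_expR; nra.
  have B2 : (B0 + B0) ^+ 2 * (3 + 2 * kappa) <= 12 * C ^+ 2 * (Lambda * q * q).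
    have -> : (B0 + B0) ^+ 2 * (3 + 2 * kappa) =
        4 * C ^+ 2 * (expR (l * kappa * 2) * (3 + 2 * kappa)).
      by rewrite /B0 expRM_natr; ring.
    have -> : 12 * C ^+ 2 * (Lambda * q * q) = 4 * C ^+ 2 * (3 * (Lambda * q * q)).
      by ring.
    by apply: ler_wpM2l exps; rewrite mulr_ge0// sqr_ge0.
  have h : (Lambda * q)^-1 * (\int[P]_w s w ^+ 2) <= 12 * C ^+ 2 * (Lambda * q).
    rewrite ler_pdivrMl//; apply: (le_trans S2).
    rewrite -/Lambda (_ : Lambda * q * _ = 12 * C ^+ 2 * (Lambda * q * q) * Lambda); last by ring.
    by rewrite ler_wpM2r// ltW.
  apply: (@le_trans _ _ (Lambda * q * (6 * C ^+ 2 + 2^-1))); first lra.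
  rewrite (_ : Lambda * (_ * eps) = Lambda * eps * (6 * C ^+ 2 + 2^-1)); last by ring.
  apply: ler_wpM2r.
    by rewrite addr_ge0// mulr_ge0// sqr_ge0.
  by rewrite ler_wpM2l// ltW.
have := lerD h1 (lerD h2 h3); move/le_trans; apply.
rewrite le_eqVlt; apply/orP; left; apply/eqP; ring.
Qed.

End L1_bound.

(** * Almost sure convergence of tame averages *)

(** The series of the [`|Y i w|] has finite integral, hence is almost surely
    finite. *)
Lemma ae_cvg0_summable_L1 {R : realType} {d : measure_display}
    {T : measurableType d} (P : probability T R) (Y : nat -> T -> R) (B : R) :
  (forall i, measurable_fun setT (Y i)) ->
  (forall i, P.-integrable setT (EFin \o (fun w => `|Y i w|))) ->
  (forall n, \sum_(0 <= i < n) \int[P]_w `|Y i w| <= B) ->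
  {ae P, forall w, Y i w @[i --> \oo] --> 0}.
Proof.
move=> mY iY sumY.
pose S w := (\sum_(i <oo) (`|Y i w|)%:E)%E.
have mnY i : measurable_fun setT (fun w => (`|Y i w|)%:E).
  by apply/measurable_EFinP/measurableT_comp => //; exact: normr_measurable.
have iS : P.-integrable setT S.
  apply/integrableP; split.
    by apply: ge0_emeasurable_sum => // i w _ _; rewrite lee_fin.
  under eq_integral do rewrite gee0_abs ?nneseries_ge0//.
  rewrite integral_nneseries//.
  apply: (@le_lt_trans _ _ B%:E); last exact: ltry.
  apply: lime_le.
    by apply: is_cvg_nneseries => n _ _; apply: integral_ge0 => w _; rewrite lee_fin.
  apply: nearW => n; have := sumY n; rewrite -lee_fin; apply: le_trans.
  rewrite -sumEFin le_eqVlt; apply/orP; left; apply/eqP; apply: eq_bigr => i _.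
  by rewrite /Rintegral fineK//; exact: (integrable_fin_num measurableT (iY i)).
have := integrable_ae measurableT iS; apply: filterS => w /(_ I) Sfin.
apply: norm_cvg0; apply: (@cvg_series_cvg_0 _ R^o (fun i => `|Y i w|)); apply: nondecreasing_is_cvgn.
  apply/nondecreasing_seqP => n; rewrite /series/= big_nat_recr//= lerDl//.
exists (fine (S w)) => _ [n _ <-]; rewrite -lee_fin fineK// /series/= -sumEFin.
exact: nneseries_lim_ge.
Qed.

(** Comparison with the telescoping sum of [2 / i - 2 / (i + 1)]. *)
Lemma sum_inv_sqr_le {R : realType} (n : nat) :
  \sum_(0 <= i < n) ((i.+1%:R : R) ^+ 2)^-1 <= 2.
Proof.
apply: (@le_trans _ _ (2 - 2 / n.+1%:R)); last by rewrite gerBl// divr_ge0.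
elim: n => [|n IH]; first by rewrite big_geq// divr1 subrr.
rewrite big_nat_recr//=; apply: (le_trans (lerD IH (lexx _))).
have x1 : 1 <= n.+1%:R :> R by rewrite ler1n.
have -> : n.+2%:R = n.+1%:R + 1 :> R by rewrite natr1.
move: x1; move: (n.+1%:R : R) => x x1.
rewrite -subr_ge0 (_ : _ - _ = (x - 1) / (x ^+ 2 * (x + 1))); last first.
  by field; rewrite !gt_eqF; lra.
by rewrite divr_ge0 ?subr_ge0// mulr_ge0 ?sqr_ge0//; lra.
Qed.

Section first_passage.
Context {R : realType}.
Variable a : nat -> R.
Hypothesis a_ge0 : forall k, 0 <= a k.
Local Notation A n := (\sum_(k < n) a k).

Lemma weight_nondecreasing m n : (m <= n)%N -> A m <= A n.
Proof.
move=> mn; rewrite -!(big_mkord xpredT) (big_cat_nat _ mn)//=.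
by rewrite lerDl sumr_ge0.
Qed.

Hypothesis a_le1 : forall k, a k <= 1.
Hypothesis A_oo : A n @[n --> \oo] --> +oo.

Lemma first_passage (x : nat -> R) : (forall i, 0 < x i) ->
  exists N : nat -> nat, forall i,
    [/\ x i <= A (N i), A (N i) <= x i + 1 &
        forall n, x i <= A n -> (N i <= n)%N].
Proof.
move=> x0.
suff H i : exists N, [/\ x i <= A N, A N <= x i + 1 &
    forall n, x i <= A n -> (N <= n)%N].
  by have [N HN] := boolp.choice H; exists N.
have ex : exists n, x i <= A n.
  have /cvgryPge/(_ (x i)) [n _ Hn] := A_oo.
  by exists n; apply: Hn => /=.
have [N xN Nmin] := ex_minnP ex; exists N; split => //.
case: N xN Nmin => [|N] xN Nmin.
  by move: xN; rewrite big_ord0 leNgt x0.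
have AN : A N < x i.
  by rewrite ltNge; apply/negP => /Nmin; rewrite ltnn.
by rewrite big_ord_recr/= lerD// ltW.
Qed.


(** If [A n] lies between the thresholds [i.+1 ^ p] and [i.+2 ^ p], then [n] lies
    between [N i] and [N i.+1]; by monotonicity the average at [n] lies between
    those at [N i] and [N i.+1], up to ratios that tend to 1. *)
Lemma cvg_weighted_average_passage (p : nat) (N : nat -> nat) (g : nat -> R)
    (m : R) : (0 < p)%N ->
  (forall k, 0 <= g k) ->
  (forall i, [/\ i.+1%:R ^+ p <= A (N i), A (N i) <= i.+1%:R ^+ p + 1 &
     forall n, i.+1%:R ^+ p <= A n -> (N i <= n)%N]) ->
  (\sum_(k < N i) a k * g k) / A (N i) @[i --> \oo] --> m ->
  (\sum_(k < n) a k * g k) / A n @[n --> \oo] --> m.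
Proof.
move=> p0 g0 HN rm.
pose r i := (\sum_(k < N i) a k * g k) / A (N i).
pose x i : R := i.+1%:R ^+ p.
have x0 i : 0 < x i by rewrite exprn_gt0.
have S_nd j n : (j <= n)%N -> \sum_(k < j) a k * g k <= \sum_(k < n) a k * g k.
  move=> jn; rewrite -!(big_mkord xpredT (fun k => a k * g k)).
  rewrite (big_cat_nat _ jn)//= lerDl sumr_ge0// => k _; exact: mulr_ge0.
have S0 n : 0 <= \sum_(k < n) a k * g k.
  by apply: sumr_ge0 => k _; exact: mulr_ge0.
have inv0 : (i.+1%:R : R)^-1 @[i --> \oo] --> (0 : R) by exact: cvg_harmonic.
have ratio : x i.+1 / x i @[i --> \oo] --> (1 : R).
  have -> : (fun i => x i.+1 / x i) = (fun i => (1 + (i.+1%:R : R)^-1) ^+ p).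
    apply/funext => i; rewrite /x -exprVn -exprMn; congr (_ ^+ p).
    by rewrite -(natr1 i.+1) mulrDl divff ?pnatr_eq0// div1r.
  have h1 : 1 + (i.+1%:R : R)^-1 @[i --> \oo] --> (1 : R).
    by rewrite -[X in _ --> X]addr0; apply: cvgD => //; exact: cvg_cst.
  have := cvg_comp _ _ h1 (@exprn_continuous R p 1).
  by rewrite expr1n.
have ratio' : x i / x i.+1 @[i --> \oo] --> (1 : R).
  have -> : (fun i => x i / x i.+1) = (fun i => (x i.+1 / x i)^-1).
    by apply/funext => i; rewrite invf_div.
  by rewrite -[X in _ --> X]invr1; apply: cvgV => //; exact: oner_neq0.
pose U i := r i.+1 * (x i.+1 / x i + (x i)^-1).
pose V i := r i * (x i / x i.+1).
have xinv : (x i)^-1 @[i --> \oo] --> (0 : R).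
  have h := cvg_comp _ _ inv0 (@exprn_continuous R p 0).
  move: h; rewrite expr0n gtn_eqF//; apply: cvg_trans; apply: near_eq_cvg.
  by apply: nearW => i /=; rewrite /x exprVn.
have Um : U i @[i --> \oo] --> m.
  rewrite -[X in _ --> X]mulr1 -[X in _ * X]addr0.
  apply: cvgM; first by rewrite (cvg_shiftS r).
  exact: cvgD.
have Vm : V i @[i --> \oo] --> m.
  by rewrite -[X in _ --> X]mulr1; exact: cvgM.
apply/cvgrPdist_lt => e e0.
have /cvgrPdist_lt/(_ e e0) [I1 _ HU] := Um.
have /cvgrPdist_lt/(_ e e0) [I2 _ HV] := Vm.
pose I := maxn I1 I2.
have /cvgryPge/(_ (x I)) [n0 _ Hn0] := A_oo.
exists n0 => // n /= n0n.
have xIA : x I <= A n by exact: Hn0.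
(* the last threshold passed by [A n] *)
have [i Ii [xi xi1]] : exists2 i, (I <= i)%N & x i <= A n /\ A n < x i.+1.
  have bnd i : x i <= A n -> (i <= Num.bound (A n))%N.
    move=> xA; have A0 : 0 <= A n by exact: le_trans (ltW (x0 i)) xA.
    have : (i.+1%:R : R) < (Num.bound (A n))%:R.
      apply: le_lt_trans (archi_boundP A0); apply: le_trans xA.
      by rewrite /x -[leLHS]expr1 ler_weXn2l// ler1n.
    by rewrite ltr_nat => /ltnW/ltnW.
  have [i xi imax] := ex_maxnP (ex_intro (fun i => x i <= A n) I xIA) bnd.
  exists i; first exact: imax.
  by split => //; rewrite ltNge; apply/negP => /imax; rewrite ltnn.
have [h1 h2 h3] := HN i; have [k1 k2 k3] := HN i.+1.
have An0 : 0 < A n by exact: lt_le_trans (x0 i) xi.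
have Nin : (N i <= n)%N by exact: h3.
have nNi : (n <= N i.+1)%N.
  rewrite leqNgt; apply/negP => /ltnW /weight_nondecreasing.
  by rewrite leNgt (lt_le_trans xi1).
have lo : V i <= (\sum_(k < n) a k * g k) / A n.
  have S0N := S0 (N i); have SN := S_nd _ _ Nin.
  have r0 : 0 <= r i by rewrite /r divr_ge0// (le_trans (ltW (x0 i))).
  have ANi : 0 < A (N i) by exact: lt_le_trans (x0 i) h1.
  rewrite ler_pdivlMr//.
  apply: (le_trans _ SN); rewrite [leRHS](_ : _ = r i * A (N i)); last first.
    by rewrite /r divfK// gt_eqF.
  rewrite /V -mulrA; apply: ler_wpM2l => //; apply: (le_trans _ h1).
  by rewrite -mulrA ler_piMr ?(ltW (x0 _))// ler_pdivrMl// mulr1 ltW.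
have hi : (\sum_(k < n) a k * g k) / A n <= U i.
  have SN := S_nd _ _ nNi.
  have ANi : 0 < A (N i.+1) by exact: lt_le_trans (x0 i.+1) k1.
  rewrite ler_pdivrMr//; apply: (le_trans SN).
  rewrite [leLHS](_ : _ = r i.+1 * A (N i.+1)); last first.
    by rewrite /r divfK// gt_eqF.
  rewrite /U -(mulrA (r i.+1)); apply: ler_wpM2l; first by rewrite /r divr_ge0// ltW.
  apply: (le_trans k2); rewrite -/(x i.+1).
  have -> : x i.+1 / x i + (x i)^-1 = (x i.+1 + 1) / x i.
    by rewrite mulrDl mul1r.
  by rewrite mulrAC ler_pdivlMr// ler_wpM2l// addr_ge0// ltW.
have := HU i (leq_trans (leq_maxl _ _) Ii).
have := HV i (leq_trans (leq_maxr _ _) Ii).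
rewrite /= !ltr_distlC => /andP[v1 v2] /andP[u1 u2].
by rewrite (lt_le_trans v1)// (le_lt_trans hi).
Qed.

End first_passage.

Section almost_sure_averages.
Context {R : realType} {dd : measure_display} {Omega : measurableType dd}.
Variable P : probability Omega R.
Local Notation N01 := (@normal_prob R 0 1).

(** The scale [kappa] measures a distance in logarithmic time.  The picture is
    that [Z k] only depends on a window of length about [kappa] ending at [k] and
    that [far] holds when two windows do not overlap, so that the indices not far
    from [k] have total weight about [2 * kappa]. *)
Definition decoupled (a : nat -> R) (X : nat -> Omega -> R) : Prop :=
  forall kappa : R, 0 <= kappa ->
  exists (V Z : nat -> Omega -> R) (far : nat -> nat -> bool),
  [/\ (forall k, std_normal P (V k)) /\ (forall k, std_normal P (Z k)),
      forall k w, `|X k w - Z k w| <=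
        expR (- (kappa / 2)) * (`|V k w| + `|Z k w|),
      forall j k, far j k -> independent_pair P (Z j) (Z k) &
      forall n k, \sum_(j < n | ~~ far j k) a j <= 3 + 2 * kappa].

Variables (a : nat -> R) (X : nat -> Omega -> R).
Hypothesis a_ge0 : forall k, 0 <= a k.
Hypothesis a_le1 : forall k, a k <= 1.
Local Notation A n := (\sum_(k < n) a k).
Hypothesis A_oo : A n @[n --> \oo] --> +oo.
Hypothesis nX : forall k, std_normal P (X k).
Hypothesis decX : decoupled a X.

(** At the [i]-th threshold [kappa] is chosen such that [expR (4 * kappa)] is the
    threshold; the rate [expR (- al * kappa)] is then at most [i.+1 ^- 2] because
    [al * p >= 8]. *)
Lemma ge0_tame_average (l : R) (G : R -> R) :
  0 <= l -> l < 1 / 2 -> tame l G -> (forall x, 0 <= G x) ->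
  {ae P, forall w, (\sum_(k < n) a k * G (X k w)) / A n @[n --> \oo] -->
    \int[N01]_x G x}.
Proof.
move=> l0 l2 tG G0; pose l' := (l + 1 / 2) / 2.
have ll' : l < l' by rewrite /l'; lra.
have l'2 : l' < 1 / 2 by rewrite /l'; lra.
have [C C0 HC] := weighted_sum_L1 P l0 ll' l'2 tG.
have al0 : 0 < l' - l by lra.
move: {l'2 ll'} (l' - l) al0 HC => al al0 HC.
pose p := (Num.bound (8 / al)).+1.
have p_al : 8 <= al * p%:R.
  rewrite mulrC -ler_pdivrMr// /p; apply: ltW.
  have b0 : 0 <= 8 / al by rewrite divr_ge0// ltW.
  by apply: (lt_trans (archi_boundP b0)); rewrite ltr_nat.
set m := \int[N01]_x G x.
have i0 (i : nat) : 0 < i.+1%:R :> R by rewrite ltr0n.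
have [N HN] : exists N : nat -> nat, forall i,
    [/\ i.+1%:R ^+ p <= A (N i), A (N i) <= i.+1%:R ^+ p + 1 &
        forall n, i.+1%:R ^+ p <= A n -> (N i <= n)%N].
  by apply: first_passage => // i; rewrite exprn_gt0.
have AN i : 0 < A (N i) by case: (HN i) => h _ _; apply: lt_le_trans h; rewrite exprn_gt0.
pose D i w := \sum_(k < N i) a k * (G (X k w) - m).
pose Y i w := (A (N i))^-1 * D i w.
have mG := tame_measurable tG.
have mX k : measurable_fun setT (X k) by case: (nX k).
have mD i : measurable_fun setT (D i).
  apply: measurable_sum => k; apply: measurable_funM => //.
  by apply: measurable_funB => //; exact: measurableT_comp.
have bound i : P.-integrable setT (EFin \o (fun w => `|D i w|)) /\
    \int[P]_w `|D i w| <= A (N i) * (C * (i.+1%:R ^+ 2)^-1).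
  pose kappa := p%:R / 4 * ln (i.+1%:R : R).
  have ln0 : 0 <= ln (i.+1%:R : R) by rewrite ln_ge0// ler1n.
  have kappa0 : 0 <= kappa by rewrite mulr_ge0// divr_ge0.
  have [V [Z [far [[nV nZ] XZ ind sumfar]]]] := decX kappa0.
  have expE : expR (4 * kappa) = i.+1%:R ^+ p.
    rewrite (_ : 4 * kappa = ln (i.+1%:R : R) * p%:R); last by rewrite /kappa; field.
    by rewrite expRM_natr lnK ?posrE.
  have [h1 _ _] := HN i; rewrite -expE in h1.
  have [iD leD] := HC _ _ _ _ _ _ _ kappa0 a_ge0 nX nV nZ XZ ind
    (fun k _ => sumfar (N i) k) h1.
  split => //; apply: (le_trans leD).
  rewrite -/(A (N i)) (_ : C * A (N i) * _ = A (N i) * (C * expR (- (al * kappa))));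
    last by ring.
  rewrite ler_wpM2l ?(ltW (AN i))// ler_wpM2l//.
  rewrite -[i.+1%:R]lnK ?posrE// -expRM_natr -expRN ler_expR.
  rewrite /kappa; nra.
have nY i : (fun w => `|Y i w|) = (fun w => (A (N i))^-1 * `|D i w|).
  by apply/funext => w; rewrite /Y normrM ger0_norm// invr_ge0 ltW.
have aeY : {ae P, forall w, Y i w @[i --> \oo] --> 0}.
  apply: (@ae_cvg0_summable_L1 _ _ _ P Y (C * 2)).
  - by move=> i; apply: measurable_funM => //; exact: mD.
  - by move=> i; rewrite nY; apply: integrableZl_fun; case: (bound i).
  - move=> n; apply: (@le_trans _ _ (\sum_(0 <= i < n) C * (i.+1%:R ^+ 2)^-1)).
      apply: ler_sum => i _; have [iD leD] := bound i.
      by rewrite nY RintegralZl// ler_pdivrMl.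
    by rewrite -mulr_sumr ler_wpM2l// sum_inv_sqr_le.
apply: filterS aeY => w Yw.
apply: (cvg_weighted_average_passage a_ge0 A_oo (ltn0Sn _)
  (fun k => G0 (X k w)) HN).
have -> : (fun i => (\sum_(k < N i) a k * G (X k w)) / A (N i)) =
    (fun i => Y i w + m).
  apply/funext => i; rewrite /Y.
  have -> : D i w = \sum_(k < N i) a k * G (X k w) - A (N i) * m.
    by rewrite /D; under eq_bigr do rewrite mulrBr; rewrite sumrB -mulr_suml.
  by rewrite mulrBr mulrA mulVf ?gt_eqF// mul1r subrK mulrC.
by rewrite -[X in _ --> X]add0r; apply: cvgD => //; exact: cvg_cst.
Qed.

Lemma tame_average (l : R) (G : R -> R) :
  0 <= l -> l < 1 / 2 -> tame l G ->
  {ae P, forall w, (\sum_(k < n) a k * G (X k w)) / A n @[n --> \oo] -->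
    \int[N01]_x G x}.
Proof.
move=> l0 l2 tG; have tN := tame_norm tG; have tP := tameD tG tN.
have h1 := ge0_tame_average l0 l2 tP _.
have h2 := ge0_tame_average l0 l2 tN (fun x => normr_ge0 _).
have P0 x : 0 <= (G \+ (fun x => `|G x|)) x.
  by rewrite /= -lerBlDl sub0r ler_normr lexx orbT.
apply: filterS2 (h1 P0) h2 => w w1 w2.
have -> : (fun n => (\sum_(k < n) a k * G (X k w)) / A n) =
    (fun n => (\sum_(k < n) a k * (G (X k w) + `|G (X k w)|)) / A n) \-
    (fun n => (\sum_(k < n) a k * `|G (X k w)|) / A n).
  apply/funext => n /=; rewrite -mulrBl -sumrB; congr (_ / _).
  by apply: eq_bigr => k _; ring.
have := cvgB w1 w2.
rewrite RintegralD//; [|exact: integrable_tame tG|exact: integrable_tame tN].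
by rewrite addrK; apply.
Qed.

End almost_sure_averages.

(** * Brownian motion on the logarithmic time scale *)

Section normal_scaling.
Context {R : realType}.
Local Notation mu := (@lebesgue_measure R).

Let divr_by (s : R) : measurableTypeR R -> measurableTypeR R := fun x => x / s.

Let measurable_divr_by s : measurable_fun setT (divr_by s).
Proof. exact: measurable_funM. Qed.

Lemma lebesgue_measure_dilation (s : R) (A : set R) : 0 < s -> measurable A ->
  pushforward mu (divr_by s) A = (s%:E * mu A)%E.
Proof.
move=> s0 mA.
have s0' : 0 <= s^-1 by rewrite invr_ge0 ltW.
pose nu : {measure set (measurableTypeR R) -> \bar R} :=
  mscale (NngNum s0') (pushforward mu (divr_by s)).
have nu_itv X : ocitv X -> mu X = nu (@measurable_divr_by s) X.
  move=> [[a b] _ <-] /=.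
  rewrite /mscale/= /pushforward (_ : divr_by s @^-1` _ = `]a * s, b * s]%classic).
    rewrite !lebesgue_measure_itv/= !lte_fin ltr_pM2r//.
    case: ifPn => _; last by rewrite mule0.
    by rewrite -!EFinB -EFinM -mulrBl mulrC mulfK// gt_eqF.
  apply/seteqP; split => x; rewrite /divr_by /= !in_itv/=;
    by rewrite ltr_pdivlMr// ler_pdivrMr.
have nuE : mu A = (s^-1%:E * pushforward mu (divr_by s) A)%E.
  exact: (lebesgue_measure_unique nu_itv mA).
by rewrite nuE muleA -EFinM divff ?gt_eqF// mul1e.
Qed.

(** Normalizing an increment requires the scaling of its law, obtained from that
    of Lebesgue measure by a change of variables in the density. *)
Lemma normal_prob_scale (s : R) (A : set R) : 0 < s -> measurable A ->
  normal_prob 0 s [set x | A (x / s)] = normal_prob 0 1 A.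
Proof.
move=> s0 mA.
pose f (y : measurableTypeR R) : \bar R := (normal_pdf 0 s (s * y))%:E.
have mf : measurable_fun setT f.
  apply/measurable_EFinP; apply: (measurableT_comp (measurable_normal_pdf 0 s)).
  exact: measurable_funM.
have f0 y : (0 <= f y)%E by rewrite lee_fin normal_pdf_ge0.
have s1 : 0 <= s by exact: ltW.
rewrite /normal_prob.
transitivity (\int[pushforward mu (divr_by s)]_(y in A) f y)%E.
  rewrite (ge0_integral_pushforward (@measurable_divr_by s))//; last first.
    exact: measurable_funTS.
  apply: eq_integral => x _; rewrite /f /divr_by /=; congr (normal_pdf _ _ _)%:E.
  by rewrite mulrC divfK// gt_eqF.
transitivity (\int[mscale (NngNum s1) mu]_(y in A) f y)%E.
  apply: eq_measure_integral => B mB _; exact: lebesgue_measure_dilation.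
rewrite ge0_integral_mscale//; last exact: measurable_funTS.
rewrite -ge0_integralZl//; last exact: measurable_funTS.
apply: eq_integral => y _; rewrite /f/= -EFinM; congr EFin.
rewrite !normal_pdfE ?oner_neq0 ?gt_eqF// /normal_peak /normal_fun !subr0.
rewrite mulrA; congr (_ * expR _); last by field; rewrite gt_eqF.
rewrite expr1n mul1r -mulrnAr sqrtrM ?sqr_ge0// sqrtr_sqr ger0_norm//.
by rewrite invfM mulrA divff ?gt_eqF// mul1r.
Qed.

End normal_scaling.

Section brownian_increments.
Context {R : realType} {dd : measure_display} {Omega : measurableType dd}.
Variables (P : probability Omega R) (W : R -> {RV P >-> R}).
Hypothesis hW : standard_brownian_motion W.

Lemma std_normal_increment (s t : R) : 0 <= s -> s < t ->
  std_normal P (fun w => (W t w - W s w) / Num.sqrt (t - s)).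
Proof.
move=> s0 st; have sd0 : 0 < Num.sqrt (t - s) by rewrite sqrtr_gt0 subr_gt0.
split.
  by apply: measurable_funM => //; exact: measurable_funB.
move=> A mA; rewrite -(normal_prob_scale sd0 mA).
rewrite -(bm_normal_increments hW s0 st)//.
have mdiv : measurable_fun setT (fun x : R => x / Num.sqrt (t - s)).
  exact: measurable_funM.
by rewrite -[X in measurable X]setTI; exact: mdiv.
Qed.

Lemma independent_increments (s t u v : R) : 0 <= s -> s <= t -> t <= u -> u <= v ->
  independent_pair P (fun w => W t w - W s w) (fun w => W v w - W u w).
Proof.
move=> s0 st tu uv A B mA mB.
pose tt (i : nat) := nth 0 [:: s; t; u; v] i.
have tt_nd i : (i < 3)%N -> tt i <= tt i.+1.
  by case: i => [|[|[|]]].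
pose i0 : 'I_3 := ord0. pose i2 : 'I_3 := ord_max.
pose AB (i : 'I_3) := if i == i0 then A else B.
have := bm_independent_increments hW (n := 3) s0 tt_nd (J := [fset i0; i2]%fset) (A := AB).
have mAB i : i \in [fset i0; i2]%fset -> measurable (AB i).
  by rewrite /AB; case: ifP.
move=> /(_ mAB).
rewrite big_fsetU1/=; last by rewrite !inE.
rewrite big_seq_fset1 /AB/= => <-.
congr (P _); apply/seteqP; split => w.
  by move=> [wA wB] i /=; rewrite !inE => /orP[] /eqP ->.
move=> H; split.
  by apply: (H i0); rewrite /= !inE eqxx.
by apply: (H i2); rewrite /= !inE eqxx orbT.
Qed.

End brownian_increments.

Section log_weights.
Context {R : realType}.
Variable b : nat -> R.
Hypothesis b0_ge0 : 0 <= b 0%N.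
Hypothesis b_incr : forall n, b n < b n.+1.

Definition log_weight (k : nat) : R := (b k.+1 - b k) / b k.+1.

Lemma scale_ge0 n : 0 <= b n.
Proof. by elim: n => // n IH; exact: le_trans IH (ltW _). Qed.

Lemma scale_gt0 n : 0 < b n.+1.
Proof. exact: le_lt_trans (scale_ge0 n) _. Qed.

Lemma log_weight_ge0 k : 0 <= log_weight k.
Proof. by rewrite divr_ge0 ?subr_ge0// ltW// scale_gt0. Qed.

Lemma log_weightE k : log_weight k = 1 - b k / b k.+1.
Proof. by rewrite /log_weight mulrBl divff// gt_eqF// scale_gt0. Qed.

Lemma log_weight_le1 k : log_weight k <= 1.
Proof.
by rewrite log_weightE gerBl divr_ge0 ?scale_ge0// ltW// scale_gt0.
Qed.

Lemma log_weight_le_ln k : 0 < b k -> log_weight k <= ln (b k.+1 / b k).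
Proof.
move=> bk; have b1 := scale_gt0 k.
rewrite log_weightE -[X in ln X]invf_div lnV ?posrE ?divr_gt0//.
have := expR_ge1Dx (ln (b k / b k.+1)); rewrite lnK ?posrE ?divr_gt0//; lra.
Qed.

(** A step inside the window weighs at most its logarithmic length, and these
    lengths telescope; the step that enters the window weighs at most 1. *)
Lemma log_weight_window (c D : R) n : 0 < c -> c <= D ->
  \sum_(j < n | (c < b j.+1) && (b j.+1 < D)) log_weight j <= 1 + ln (D / c).
Proof.
move=> c0 cD; have D0 : 0 < D by exact: lt_le_trans cD.
have lnDc : 0 <= ln (D / c) by rewrite ln_ge0// ler_pdivlMr// mul1r.
(* the invariant stops at [D] when [b n] has left the window *)
suff : \sum_(j < n | (c < b j.+1) && (b j.+1 < D)) log_weight j <=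
    if b n <= c then 0 else 1 + ln (Num.min (b n) D / c).
  move/le_trans; apply; case: ifPn => [_|]; first by rewrite addr_ge0.
  rewrite -ltNge => cb; rewrite lerD2l ler_ln ?posrE ?divr_gt0//.
    by rewrite ler_pM2r ?invr_gt0// ge_min lexx orbT.
  by rewrite lt_min D0 (lt_trans c0 cb).
elim: n => [|n IH].
  rewrite big_ord0; case: ifPn => // ; rewrite -ltNge => cb.
  rewrite addr_ge0// ln_ge0// ler_pdivlMr// mul1r le_min cD andbT; exact: ltW.
rewrite big_mkcond big_ord_recr/= -big_mkcond/=.
have [bc|cb] := leP (b n.+1) c.
  have bnc : b n <= c by exact: le_trans (ltW (b_incr n)) bc.
  by move: IH; rewrite bnc /= addr0.
have [Db|bD] := leP D (b n.+1); rewrite ?andbF ?andbT /=.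
  rewrite addr0; apply: (le_trans IH); case: ifPn => [_|].
    by rewrite addr_ge0.
  rewrite -ltNge => cbn; rewrite lerD2l ler_ln ?posrE ?divr_gt0//.
    by rewrite ler_pM2r ?invr_gt0// ge_min lexx orbT.
  by rewrite lt_min D0 (lt_trans c0 cbn).
have [bc|cbn] := leP (b n) c; move: IH; rewrite ?bc.
  move=> IH; rewrite (le_trans (lerD IH (log_weight_le1 n)))// add0r lerDl.
  by rewrite ln_ge0// ler_pdivlMr// mul1r ltW.
have bn0 : 0 < b n by exact: lt_trans cbn.
rewrite (lt_geF cbn) /= min_l; last exact: ltW (lt_trans _ bD).
move=> IH; apply: (le_trans (lerD IH (log_weight_le_ln bn0))).
rewrite -addrA lerD2l -lnM ?posrE ?divr_gt0 ?scale_gt0//.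
by rewrite mulrC mulrA divfK// gt_eqF.
Qed.

End log_weights.

Lemma independent_pair_sym {R : realType} {d : measure_display}
    {Omega : measurableType d} (P : probability Omega R) (X Y : Omega -> R) :
  independent_pair P X Y -> independent_pair P Y X.
Proof. by move=> XY A B mA mB; rewrite setIC muleC XY. Qed.

Section brownian_decoupling.
Context {R : realType} {dd : measure_display} {Omega : measurableType dd}.
Variables (P : probability Omega R) (W : R -> {RV P >-> R}).
Hypothesis hW : standard_brownian_motion W.
Variable b : nat -> R.
Hypothesis b0_ge0 : 0 <= b 0%N.
Hypothesis b_incr : forall n, b n < b n.+1.

(** The subtraction of [W 0], which vanishes almost surely, makes this an increment
    on every path; the index is shifted because [b 0] may be 0. *)
Definition rescaled (k : nat) (w : Omega) : R :=
  (W (b k.+1) w - W 0 w) / Num.sqrt (b k.+1).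

Lemma std_normal_rescaled k : std_normal P (rescaled k).
Proof.
have := std_normal_increment hW (lexx 0) (scale_gt0 b0_ge0 b_incr k).
by rewrite subr0.
Qed.

(** With [h = expR (kappa + 1)] and [s = b k.+1 / h], [Z k] is the normalized
    increment over [[s, b k.+1]] and [V k] the rescaled value at [s].  Then
    [rescaled k = r * V k + q * Z k] with [r ^+ 2 = h^-1] and
    [r ^+ 2 + q ^+ 2 = 1], and [1 - q <= r]. *)
Lemma brownian_decoupled : decoupled P (log_weight b) rescaled.
Proof.
move=> kappa kappa0.
pose r := expR (- ((kappa + 1) / 2)).
(* the shift by 1 keeps [s k < b k.+1] at [kappa = 0] *)
pose h := expR (kappa + 1).
have r0 : 0 < r by exact: expR_gt0.
have h1 : 1 < h by rewrite expR_gt1; lra.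
have h0 : 0 < h by lra.
have r2 : r ^+ 2 = h^-1.
  by rewrite /r /h -expRM_natr -expRN; congr expR; field.
have r2lt : r ^+ 2 < 1 by rewrite r2 invf_lt1.
have r1 : r < 1 by rewrite -(expr_lt1 (n := 2))// ltW.
have bp k := scale_gt0 b0_ge0 b_incr k.
pose s k := r ^+ 2 * b k.+1.
have s0 k : 0 < s k by rewrite mulr_gt0// exprn_gt0.
have sb k : s k < b k.+1 by rewrite gtr_pMl.
pose V k w := (W (s k) w - W 0 w) / Num.sqrt (s k).
pose Z k w := (W (b k.+1) w - W (s k) w) / Num.sqrt (b k.+1 - s k).
pose far (j k : nat) := (b j.+1 <= s k) || (b k.+1 <= s j).
exists V, Z, far; split.
- split=> k; last exact: std_normal_increment (ltW (s0 k)) (sb k).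
  by have := std_normal_increment hW (lexx 0) (s0 k); rewrite subr0.
- move=> k w.
  pose q := Num.sqrt (1 - r ^+ 2).
  have q0 : 0 <= q by exact: sqrtr_ge0.
  have q2 : q ^+ 2 = 1 - r ^+ 2 by rewrite sqr_sqrtr// subr_ge0 ltW.
  have q1 : q <= 1 by rewrite -(expr_le1 (n := 2))// q2; have := sqr_ge0 r; lra.
  have qr : 1 - q <= r by nra.
  pose sd := Num.sqrt (b k.+1).
  have sd0 : 0 < sd by rewrite sqrtr_gt0.
  have sdV : Num.sqrt (s k) = r * sd.
    by rewrite /s sqrtrM ?sqr_ge0// sqrtr_sqr ger0_norm// ltW.
  have sdZ : Num.sqrt (b k.+1 - s k) = q * sd.
    rewrite /s (_ : _ - _ = (1 - r ^+ 2) * b k.+1); last by ring.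
    by rewrite sqrtrM// subr_ge0 ltW.
  have q_gt0 : 0 < q by rewrite sqrtr_gt0 subr_gt0.
  have -> : rescaled k w - Z k w = r * V k w + (q - 1) * Z k w.
    rewrite /rescaled /V /Z sdV sdZ -/sd; field.
    by rewrite !gt_eqF.
  apply: (le_trans (ler_normD _ _)); rewrite (normrM r) (normrM (q - 1)).
  apply: (@le_trans _ _ (r * (`|V k w| + `|Z k w|))).
    rewrite mulrDr lerD//; first by rewrite (ger0_norm (ltW r0)).
    by apply: ler_wpM2r => //; rewrite distrC ger0_norm// subr_ge0.
  apply: ler_wpM2r; first by rewrite addr_ge0.
  by rewrite /r ler_expR; lra.
- have mdiv (c : R) : measurable_fun setT (fun x : R => x / c) by exact: measurable_funM.
  have H j k : b j.+1 <= s k -> independent_pair P (Z j) (Z k).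
    move=> bs; apply: (independent_pair_comp (mdiv _) (mdiv _)).
    exact: (independent_increments hW (ltW (s0 j)) (ltW (sb j)) bs (ltW (sb k))).
  by move=> j k /orP[/H//|/H]; exact: independent_pair_sym.
move=> n k.
have c0 := s0 k.
have cD : s k <= b k.+1 * h by rewrite (le_trans (ltW (sb k)))// ler_peMr// ltW.
have := log_weight_window b0_ge0 b_incr n c0 cD.
have -> : b k.+1 * h / s k = expR (2 * (kappa + 1)).
  have -> : b k.+1 * h / s k = h * h by rewrite /s r2; field; rewrite !gt_eqF.
  by rewrite /h -expRD; congr expR; ring.
rewrite expRK => H; apply: le_trans (_ : _ <= 1 + 2 * (kappa + 1)) _; last lra.
apply: le_trans H; rewrite le_eqVlt; apply/orP; left; apply/eqP.
apply: eq_bigl => j; rewrite /far negb_or -!ltNge; congr (_ && _).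
by rewrite /s r2 mulrC ltr_pdivrMr.
Qed.

End brownian_decoupling.

(** * Deterministic averages: normalization and perturbation *)

Section total_weight.
Context {R : realType}.
Variable b : nat -> R.
Hypothesis b0_ge0 : 0 <= b 0%N.
Hypothesis b_incr : forall n, b n < b n.+1.
Hypothesis b_oo : b n @[n --> \oo] --> +oo.
Hypothesis b_gap : forall e : R, 0 < e ->
  \forall n \near \oo, b n.+1 - b n <= e * b n.
Local Notation A n := (\sum_(k < n) log_weight b k).

Lemma ln_scale_oo : ln (b n) @[n --> \oo] --> +oo.
Proof.
apply/cvgryPge => x; have /cvgryPge/(_ (expR x)) := b_oo.
apply: filterS => n xb; rewrite -[x]expRK ler_ln ?posrE ?expR_gt0//.
exact: lt_le_trans (expR_gt0 _) xb.
Qed.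

Lemma total_weight_le n : A n.+1 <= 1 - ln (b 1%N) + ln (b n.+1).
Proof.
elim: n => [|n IH].
  by rewrite big_ord1 subrK log_weight_le1.
rewrite big_ord_recr/=; have bn := scale_gt0 b0_ge0 b_incr n.
have := log_weight_le_ln b0_ge0 b_incr bn.
by rewrite ln_div ?posrE ?scale_gt0//; lra.
Qed.

(** Since [ln (b k.+1 / b k) <= b k.+1 / b k - 1], the logarithmic length of a step
    exceeds its weight by a factor of at most [b k.+1 / b k <= 1 + e]. *)
Lemma ln_scale_le (e : R) : 0 < e -> exists c : R, \forall n \near \oo,
  ln (b n) <= c + (1 + e) * A n.
Proof.
move=> e0; have [K _ HK] := b_gap e0.
pose c := ln (b K.+1).
have A0 n : 0 <= A n by apply: sumr_ge0 => k _; exact: log_weight_ge0.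
exists c, K.+1 => // n /= /subnK <-; elim: (n - K.+1)%N => [|i IH].
  by rewrite add0n lerDl mulr_ge0 ?A0// addr_ge0// ltW.
rewrite addSn big_ord_recr/= mulrDr addrA.
set k := (i + K.+1)%N in IH *.
have bk : 0 < b k by rewrite /k addnS scale_gt0.
have bk1 : 0 < b k.+1 by rewrite scale_gt0.
have gap : b k.+1 - b k <= e * b k by apply: HK; rewrite /k /=; lia.
suff : ln (b k.+1) <= ln (b k) + (1 + e) * log_weight b k by lra.
rewrite -lerBlDl -ln_div ?posrE//.
have := expR_ge1Dx (b k.+1 / b k - 1); rewrite -ler_ln ?posrE ?expR_gt0//; last first.
  by rewrite addrC subrK divr_gt0.
rewrite expRK addrC subrK => /le_trans; apply.
rewrite /log_weight mulrA ler_pdivlMr//.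
rewrite (_ : (b k.+1 / b k - 1) * b k.+1 =
  (b k.+1 - b k) * (b k.+1 / b k)); last first.
  by field; rewrite gt_eqF.
rewrite [leRHS]mulrC; apply: ler_wpM2l; first by rewrite subr_ge0 ltW.
by rewrite ler_pdivrMr//; lra.
Qed.

Lemma total_weight_oo : A n @[n --> \oo] --> +oo.
Proof.
have [c Hc] := ln_scale_le (@ltr01 R).
apply/cvgryPge => x; have /cvgryPge/(_ (c + 2 * x)) := ln_scale_oo.
by apply: filterS2 Hc => n h1 h2; lra.
Qed.

Lemma total_weight_equiv : A n / ln (b n) @[n --> \oo] --> (1 : R).
Proof.
apply/cvgrPdist_le => e e0.
have e20 : 0 < e / 2 by lra.
have [c Hc] := ln_scale_le e20.
pose c1 := 1 - ln (b 1%N).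
have /cvgryPge/(_ (1 + `|c1| / e + `|c| / (e / 2))) := ln_scale_oo.
have Hn : \forall n \near \oo, (0 < n)%N by exists 1%N.
move: Hn Hc; apply: filterS3 => -[//|n] _ h1 h3.
have h2 := total_weight_le n; rewrite -/c1 in h2.
set x := ln (b n.+1) in h1 h2 h3 *; set L := A n.+1 in h1 h2 *.
have q1 : 0 <= `|c1| / e by rewrite divr_ge0// ltW.
have q2 : 0 <= `|c| / (e / 2) by rewrite divr_ge0// ltW.
have x0 : 0 < x by lra.
have k1 : c1 <= e * x.
  apply: (le_trans (ler_norm _)); rewrite mulrC -ler_pdivrMr//; lra.
have k2 : c <= e / 2 * x.
  apply: (le_trans (ler_norm _)); rewrite mulrC -ler_pdivrMr//; lra.
have L0 : 0 <= L by apply: sumr_ge0 => k _; exact: log_weight_ge0.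
rewrite ler_distlC; apply/andP; split.
  rewrite ler_pdivlMr//; nra.
rewrite ler_pdivrMr//; nra.
Qed.

End total_weight.

Section weighted_averages.
Context {R : realType}.
Variable a : nat -> R.
Hypothesis a_ge0 : forall k, 0 <= a k.
Local Notation A n := (\sum_(k < n) a k).
Hypothesis A_oo : A n @[n --> \oo] --> +oo.

(** A Cesaro argument: finitely many terms are negligible because the total weight
    is infinite, and the others are a small multiple of a bounded average. *)
Lemma cvg_weighted_average_small (u v : nat -> R) (m : R) :
  (forall k, 0 <= v k) ->
  (forall e : R, 0 < e -> \forall k \near \oo, `|u k| <= e * v k) ->
  (\sum_(k < n) a k * v k) / A n @[n --> \oo] --> m ->
  (\sum_(k < n) a k * u k) / A n @[n --> \oo] --> (0 : R).
Proof.
move=> v0 uv vm; apply/cvgrPdist_le => e e0.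
have m0 : 0 < `|m| + 1 by rewrite ltr_wpDl.
pose e1 := e / 2 / (`|m| + 1).
have e10 : 0 < e1 by rewrite !divr_gt0.
have [K _ HK] := uv _ e10.
pose c := \sum_(k < K) a k * `|u k|.
have /cvgrPdist_le/(_ _ (@ltr01 R)) H1 := vm.
have /cvgryPge/(_ (1 + `|c| / (e / 2))) := A_oo.
have [K1 _ HK1] : \forall n \near \oo, (K <= n)%N by exists K.
move: H1; apply: filterS3 (ex_intro2 _ _ K1 I HK1) => n /= Kn H1 An.
have q0 : 0 <= `|c| / (e / 2) by rewrite divr_ge0// divr_ge0// ltW.
have A0 : 0 < A n by lra.
rewrite sub0r normrN normrM normfV (ger0_norm (ltW A0)) ler_pdivrMr//.
apply: (@le_trans _ _ (c + e1 * \sum_(k < n) a k * v k)).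
  apply: (le_trans (ler_norm_sum _ _ _)).
  rewrite -(big_mkord xpredT (fun k => `|a k * u k|)).
  rewrite -(big_mkord xpredT (fun k => a k * v k)).
  rewrite [leLHS](big_cat_nat _ Kn)//= [X in _ * X](big_cat_nat _ Kn)//= big_mkord mulrDr addrA; apply: lerD.
    apply: (@le_trans _ _ c).
      by apply: ler_sum => k _; rewrite normrM (ger0_norm (a_ge0 _)).
    rewrite lerDl mulr_ge0// ?(ltW e10)// sumr_ge0// => k _; exact: mulr_ge0.
  rewrite mulr_sumr big_nat_cond [leRHS]big_nat_cond; apply: ler_sum => k.
  rewrite andbT => /andP[Kk _].
  by rewrite normrM (ger0_norm (a_ge0 _)) mulrCA ler_wpM2l// HK.
set S := \sum_(k < n) a k * v k in H1 *.
have S1 : S <= (`|m| + 1) * A n.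
  rewrite -ler_pdivrMr//; move: H1; rewrite ler_distlC => /andP[_ H1].
  by apply: (le_trans H1); rewrite lerD2r ler_norm.
have c1 : c <= e / 2 * A n.
  apply: (le_trans (ler_norm _)); rewrite mulrC -ler_pdivrMr//; lra.
have e1S : e1 * S <= e / 2 * A n.
  apply: (@le_trans _ _ (e1 * ((`|m| + 1) * A n))); first by rewrite ler_wpM2l// ltW.
  by rewrite mulrA /e1 divfK ?gt_eqF.
lra.
Qed.

(** A tame function moves by at most the displacement times a slightly larger
    Gaussian weight, whose average stays bounded. *)
Lemma cvg_tame_average_perturb (l l' : R) (G : R -> R) (x y : nat -> R) (m I : R) :
  0 <= l -> l < l' -> tame l G ->
  (x k - y k @[k --> \oo] --> 0) ->
  (\sum_(k < n) a k * gexp l' (x k)) / A n @[n --> \oo] --> I ->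
  (\sum_(k < n) a k * G (x k)) / A n @[n --> \oo] --> m ->
  (\sum_(k < n) a k * G (y k)) / A n @[n --> \oo] --> m.
Proof.
move=> l0 ll' [_ [C C0 [_ lipG]]] xy gI Gm.
pose c := expR (l * (1 + l / (l' - l))).
have c0 : 0 <= c by exact: expR_ge0.
have D0 : 0 < C * (1 + c) + 1 by rewrite ltr_wpDl// mulr_ge0// addr_ge0.
have small : (\sum_(k < n) a k * (G (x k) - G (y k))) / A n @[n --> \oo] --> (0 : R).
  have g0 k : 0 <= gexp l' (x k) by exact: gexp_ge0.
  have uv : forall e, 0 < e ->
      \forall k \near \oo, `|G (x k) - G (y k)| <= e * gexp l' (x k).
    move=> e e0.
    have e10 : 0 < e / (C * (1 + c) + 1) by rewrite divr_gt0.
    have /cvgrPdist_le H := xy.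
    apply: filterS2 (H _ e10) (H _ (@ltr01 R)) => k.
    rewrite !sub0r !normrN => h1 h2.
    apply: (le_trans (lipG _ _)).
    have g1 : gexp l (x k) <= gexp l' (x k) by rewrite ler_gexp// ltW.
    have g2 : gexp l (y k) <= c * gexp l' (x k) by exact: gexp_near.
    have g3 := g0 k.
    apply: (@le_trans _ _ (`|x k - y k| * (C * (1 + c) + 1) * gexp l' (x k))).
      rewrite mulrCA -mulrA ler_wpM2l//.
      apply: (@le_trans _ _ (C * ((1 + c) * gexp l' (x k)))); last nra.
      rewrite ler_wpM2l//; lra.
    by rewrite ler_wpM2r// -ler_pdivlMr.
  exact: (cvg_weighted_average_small g0 uv gI).
have -> : (fun n => (\sum_(k < n) a k * G (y k)) / A n) =
    (fun n => (\sum_(k < n) a k * G (x k)) / A n) \-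
    (fun n => (\sum_(k < n) a k * (G (x k) - G (y k))) / A n).
  apply/funext => n /=; rewrite -mulrBl -sumrB; congr (_ / _).
  by apply: eq_bigr => k _; ring.
have := cvgB Gm small; rewrite subr0; apply.
Qed.

End weighted_averages.

(** * Approximation of the class by tame functions *)

Section tame_approximation.
Context {R : realType}.

(** Heine's theorem on a segment, outside of which [h] is small. *)
Lemma unif_continuous_vanishing (h : R -> R) : continuous h ->
  (forall e, 0 < e -> exists K, forall x, K <= `|x| -> `|h x| <= e) ->
  forall e, 0 < e -> exists2 eta, 0 < eta &
    forall x y, `|x - y| <= eta -> `|h x - h y| <= e.
Proof.
move=> ch h_oo e e0; have e20 : 0 < e / 2 by lra.
have [K HK] := h_oo _ e20.
pose near_const (i x : R) := forall y, `|x - y| < i -> `|h x - h y| <= e.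
have : \forall i \near (0 : R)^'+, `[- (K + 1), K + 1]%classic `<=` near_const i.
  apply: (proj1 (compact_near_coveringP _) (@segment_compact R _ _)) => x _.
  have /cvgrPdist_lt/(_ _ e20)/nbhs_ballP[d /= d0 Hd] := ch x.
  have d20 : 0 < d / 2 by lra.
  exists (ball x (d / 2), [set i : R | i < d / 2]) => /=.
    split; first exact: nbhsx_ballx.
    exact: nbhs_right_lt.
  move=> [x' i] /= [xx' id] y x'y.
  have h1 : `|h x - h x'| < e / 2.
    apply: Hd; rewrite /ball/=; rewrite /ball/= in xx'; lra.
  have h2 : `|h x - h y| < e / 2.
    apply: Hd; rewrite /ball/=; rewrite /ball/= in xx'.
    apply: le_lt_trans (ler_distD x' _ _) _; lra.
  apply: le_trans (ler_distD (h x) _ _) _; rewrite (distrC (h x')); lra.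
move=> near_i.
have [i [i0 Hi]] : exists i : R, 0 < i /\ `[- (K + 1), K + 1]%classic `<=` near_const i.
  have /filter_ex[i [i0 Hi]] : \forall i \near (0 : R)^'+, 0 < i /\
      `[- (K + 1), K + 1]%classic `<=` near_const i.
    by apply: filterI near_i; exact: nbhs_right_gt.
  by exists i.
exists (Num.min (i / 2) 1); first by rewrite lt_min ltr01 andbT; lra.
move=> x y; rewrite le_min => /andP[xyi xy1].
have [xK|Kx] := leP `|x| (K + 1).
  by apply: Hi; rewrite /= ?in_itv/= -?ler_norml//; lra.
apply: le_trans (ler_normB _ _) _.
have h1 : `|h x| <= e / 2 by apply: HK; lra.
have h2 : `|h y| <= e / 2.
  apply: HK; have := ler_distD y x 0; rewrite !subr0; lra.
lra.
Qed.

(** The inf-convolution of [h] with a cone of slope [2 / eta] is Lipschitz and lies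
    below [h].  Points farther than [eta] do not lower it, since there the cone
    exceeds the oscillation of [h], and nearer points lower it by at most [e]. *)
Lemma lipschitz_approx (h : R -> R) (e eta : R) :
  0 < e -> 0 < eta -> (forall x, `|h x| <= 1) ->
  (forall x y, `|x - y| <= eta -> `|h x - h y| <= e) ->
  exists (psi : R -> R) (L : R), [/\ 0 <= L, forall x, `|psi x| <= 1,
    forall x y, `|psi x - psi y| <= L * `|x - y| &
    forall x, `|h x - psi x| <= e].
Proof.
move=> e0 eta0 h1 hu.
pose L := 2 / eta; have L0 : 0 <= L by rewrite divr_ge0// ltW.
pose cone x := [set h y + L * `|x - y| | y in [set: R]].
pose psi x := inf (cone x).
have hlo y : -1 <= h y by have := h1 y; rewrite ler_norml => /andP[].
have hhi y : h y <= 1 by have := h1 y; rewrite ler_norml => /andP[].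
have cone0 x : nonempty (cone x) by exists (h x + L * `|x - x|), x.
have cone_lb x : has_lbound (cone x).
  exists (-1) => _ [y _ <-]; have : 0 <= L * `|x - y| by exact: mulr_ge0.
  have := hlo y; lra.
have psi_le x y : psi x <= h y + L * `|x - y|.
  by apply: ge_inf => //; exists y.
have psi_ge x c : (forall y, c <= h y + L * `|x - y|) -> c <= psi x.
  by move=> H; apply: lb_le_inf => // _ [y _ <-].
have psi_h x : psi x <= h x by have := psi_le x x; rewrite subrr normr0 mulr0 addr0.
exists psi, L; split => //.
- move=> x; rewrite ler_norml (le_trans (psi_h x) (hhi x)) andbT.
  apply: psi_ge => y; have : 0 <= L * `|x - y| by exact: mulr_ge0.
  have := hlo y; lra.
- have half x y : psi x - psi y <= L * `|x - y|.
    rewrite lerBlDl -lerBlDr; apply: psi_ge => z.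
    rewrite lerBlDr; apply: (le_trans (psi_le x z)).
    rewrite -addrA lerD2l -mulrDr ler_wpM2l// [leRHS]addrC; exact: ler_distD.
  move=> x y; rewrite ler_norml half andbT lerNl opprB distrC; exact: half.
- move=> x; rewrite ger0_norm ?subr_ge0// lerBlDl -lerBlDr.
  apply: psi_ge => y; have [xy|xy] := leP `|x - y| eta.
    have := hu _ _ xy; rewrite ler_distlC => /andP[hxy _].
    have : 0 <= L * `|x - y| by exact: mulr_ge0.
    move: hxy; lra.
  have : 2 <= L * `|x - y|.
    by rewrite /L mulrAC ler_pdivlMr// ler_wpM2l// ltW.
  have := hlo y; have := hhi x; lra.
Qed.

Lemma tame_lipschitzM (l l' L : R) (psi : R -> R) : 0 <= l -> l < l' -> 0 <= L ->
  (forall x, `|psi x| <= 1) ->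
  (forall x y, `|psi x - psi y| <= L * `|x - y|) ->
  tame l' (fun x => psi x * gexp l x).
Proof.
move=> l0 ll' L0 psi1 psiL.
have cpsi : continuous psi.
  move=> x; apply/cvgrPdist_le => e e0.
  have L1 : 0 < L + 1 by lra.
  apply/nbhs_ballP; exists (e / (L + 1)) => /=; first exact: divr_gt0.
  move=> y; rewrite /ball/= => xy; apply: (le_trans (psiL _ _)).
  move: xy; rewrite ltr_pdivlMr// => xy; have := normr_ge0 (x - y); nra.
split.
  apply: measurable_funM; first exact: continuous_measurable_fun.
  exact: measurable_gexp.
have [_ [C C0 [leg lipg]]] := tame_gexp l0 ll'.
have gg' x : gexp l x <= gexp l' x by rewrite ler_gexp// ltW.
exists (1 + L + C); first by rewrite !addr_ge0.
split=> [x|x y].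
  rewrite normrM (ger0_norm (gexp_ge0 _ _)).
  apply: (@le_trans _ _ (1 * gexp l' x)).
    by rewrite ler_pM ?gexp_ge0.
  by rewrite ler_wpM2r ?gexp_ge0// -addrA lerDl addr_ge0.
have -> : psi x * gexp l x - psi y * gexp l y =
  (psi x - psi y) * gexp l x + psi y * (gexp l x - gexp l y) by ring.
apply: le_trans (ler_normD _ _) _; rewrite !normrM.
apply: (@le_trans _ _ (L * `|x - y| * (gexp l' x + gexp l' y) +
    1 * (C * (`|x - y| * (gexp l' x + gexp l' y))))).
  apply: lerD; apply: ler_pM => //.
  rewrite (ger0_norm (gexp_ge0 _ _)); apply: (le_trans (gg' x)).
  by rewrite lerDl gexp_ge0.
rewrite -mulrA mul1r -mulrDl ler_wpM2r//; last by rewrite lerD2r lerDr.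
by rewrite mulr_ge0// addr_ge0// gexp_ge0.
Qed.

(** Divided by a Gaussian weight of exponent larger than its own, [f] vanishes at
    infinity, hence is uniformly continuous and uniformly approximated by bounded
    Lipschitz functions; multiplying back gives tame functions. *)
Lemma class_Ce_tame_approx (f : R -> R) : class_Ce f ->
  exists l : R, [/\ 0 <= l, l < 1 / 2, forall x, `|f x| <= gexp l x &
    forall e, 0 < e -> exists2 G, tame l G &
      forall x, `|f x - G x| <= e * gexp l x].
Proof.
move=> [cf [gamma gamma2 fle]].
pose g0 := Num.max gamma 0.
have g00 : 0 <= g0 by rewrite /g0 le_max lexx orbT.
have g02 : g0 < 1 / 2 by rewrite /g0 gt_max gamma2; lra.
have fle' x : `|f x| <= gexp g0 x.
  by apply: (le_trans (fle x)); apply: ler_gexp; rewrite /g0 le_max lexx.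
pose l1 := (g0 + 1 / 2) / 2; pose l := (l1 + 1 / 2) / 2.
have [l01 l12 l13] : [/\ g0 < l1, l1 < l & l < 1 / 2] by rewrite /l /l1; split; lra.
have l10 : 0 <= l1 by lra.
exists l; split => [||x|e e0]; [lra| by []| |].
  by apply: (le_trans (fle' x)); rewrite ler_gexp//; lra.
pose h x := f x * gexp (- l1) x.
have hle x : `|h x| <= gexp (g0 - l1) x.
  by rewrite normrM (ger0_norm (gexp_ge0 _ _)) -gexpM ler_wpM2r ?gexp_ge0.
have h1 x : `|h x| <= 1.
  apply: (le_trans (hle x)); rewrite /gexp -expR0 ler_expR.
  have := sqr_ge0 x; nra.
have ch : continuous h by move=> x; apply: cvgM; [exact: cf|exact: continuous_gexp].
have d0 : 0 < l1 - g0 by lra.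
have h_oo : forall e', 0 < e' -> exists K, forall x, K <= `|x| -> `|h x| <= e'.
  move=> e' e'0; pose K := 1 + ((l1 - g0) * e')^-1.
  have q0 : 0 < (l1 - g0) * e' by exact: mulr_gt0.
  have q1 : 0 < ((l1 - g0) * e')^-1 by rewrite invr_gt0.
  exists K => x Kx; apply: (le_trans (hle x)).
  have -> : g0 - l1 = - (l1 - g0) by ring.
  rewrite /gexp mulNr expRN invf_ple ?posrE ?expR_gt0//.
  apply: (@le_trans _ _ (1 + (l1 - g0) * x ^+ 2)); last exact: expR_ge1Dx.
  have K2 : ((l1 - g0) * e')^-1 <= x ^+ 2.
    rewrite -[x ^+ 2]real_normK ?num_real//; rewrite /K in Kx; nra.
  apply: (@le_trans _ _ ((l1 - g0) * x ^+ 2)); last by rewrite lerDr.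
  apply: (@le_trans _ _ ((l1 - g0) * ((l1 - g0) * e')^-1)).
    by rewrite invfM mulrA divff ?gt_eqF// mul1r.
  by rewrite ler_wpM2l// ltW.
have [eta eta0 hu] := unif_continuous_vanishing ch h_oo e0.
have [psi [L [L0 psi1 psiL psih]]] := lipschitz_approx e0 eta0 h1 hu.
exists (fun x => psi x * gexp l1 x); first exact: tame_lipschitzM psi1 psiL.
move=> x; have -> : f x - psi x * gexp l1 x = (h x - psi x) * gexp l1 x.
  rewrite mulrBl /h -mulrA gexpM addNr {2}/gexp mul0r expR0 mulr1//.
rewrite normrM (ger0_norm (gexp_ge0 _ _)) ler_pM ?gexp_ge0//.
by rewrite ler_gexp// ltW.
Qed.

End tame_approximation.

Lemma littleo_nearP {R : realType} (u v : nat -> R) :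
  u =o_\oo v -> forall e : R, 0 < e ->
  \forall n \near \oo, `|u n| <= e * `|v n|.
Proof. by move=> /eqoP. Qed.

(** * The almost sure central limit theorem *)

Section tame_to_Ce.
Context {R : realType}.
Local Notation N01 := (@normal_prob R 0 1).
Variable a : nat -> R.
Hypothesis a_ge0 : forall k, 0 <= a k.
Local Notation A n := (\sum_(k < n) a k).
Hypothesis A_oo : A n @[n --> \oo] --> +oo.

Lemma cvg_average_approx (l : R) (f : R -> R) (G : nat -> R -> R) (y : nat -> R) :
  l < 1 / 2 -> N01.-integrable setT (EFin \o f) -> (forall n, tame l (G n)) ->
  (forall n x, `|f x - G n x| <= n.+1%:R^-1 * gexp l x) ->
  ((\sum_(k < n) a k * gexp l (y k)) / A n @[n --> \oo] --> \int[N01]_x gexp l x) ->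
  (forall i, (\sum_(k < n) a k * G i (y k)) / A n @[n --> \oo] --> \int[N01]_x G i x) ->
  (\sum_(k < n) a k * f (y k)) / A n @[n --> \oo] --> \int[N01]_x f x.
Proof.
move=> l2 iff tG fG gI GI.
set I := \int[N01]_x gexp l x in gI.
have ig := integrable_gexp l2.
have I0 : 0 <= I by apply: Rintegral_ge0 => x _; exact: gexp_ge0.
apply/cvgrPdist_le => e e0.
have q0 : 0 < e / (3 * (I + 1)) by rewrite divr_gt0//; lra.
have [i Hi] : exists i : nat, i.+1%:R^-1 * (I + 1) <= e / 3.
  have b0 : 0 <= (e / (3 * (I + 1)))^-1 by rewrite invr_ge0 ltW.
  exists (Num.bound ((e / (3 * (I + 1)))^-1)).
  rewrite -ler_pdivlMr; last lra.
  rewrite invf_ple ?posrE ?ltr0n//; last by rewrite divr_gt0//; lra.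
  rewrite (_ : e / 3 / (I + 1) = e / (3 * (I + 1))); last by rewrite invfM mulrA.
  by apply: ltW; apply: (lt_trans (archi_boundP b0)); rewrite ltr_nat.
set ei : R := i.+1%:R^-1 in Hi.
have ei0 : 0 <= ei by rewrite invr_ge0.
have e30 : 0 < e / 3 by lra.
have iGi := integrable_tame l2 (tG i).
have dint : `|\int[N01]_x f x - \int[N01]_x G i x| <= ei * I.
  rewrite -RintegralB//.
  have mfG : N01.-integrable setT (EFin \o (fun x => f x - G i x)).
    by have := integrableB measurableT iff iGi.
  apply: (le_trans (le_normr_Rintegral measurableT mfG)).
  rewrite -RintegralZl//; apply: le_Rintegral => //; last exact: integrableZl_fun.
  exact: integrable_norm.
have /cvgrPdist_le/(_ _ e30) H1 := GI i.
have /cvgrPdist_le/(_ _ (@ltr01 R)) H2 := gI.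
have /cvgryPge/(_ 1) H3 := A_oo.
move: H1 H2 H3; apply: filterS3 => n H1 H2 H3.
have A0 : 0 < A n by lra.
have dav : `|(\sum_(k < n) a k * G i (y k)) / A n - (\sum_(k < n) a k * f (y k)) / A n|
    <= ei * ((\sum_(k < n) a k * gexp l (y k)) / A n).
  rewrite -mulrBl -sumrB normrM normfV (ger0_norm (ltW A0)) mulrA.
  apply: ler_wpM2r; first by rewrite invr_ge0 ltW.
  rewrite mulr_sumr; apply: (le_trans (ler_norm_sum _ _ _)).
  apply: ler_sum => k _; rewrite -mulrBr normrM (ger0_norm (a_ge0 _)) mulrCA.
  by apply: ler_wpM2l => //; rewrite distrC; exact: fG.
have H2' : (\sum_(k < n) a k * gexp l (y k)) / A n <= I + 1.
  by move: H2; rewrite ler_distlC => /andP[].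
have k1 : ei * I <= e / 3 by apply: le_trans Hi; rewrite ler_wpM2l//; lra.
have k2 : ei * ((\sum_(k < n) a k * gexp l (y k)) / A n) <= e / 3.
  by apply: le_trans Hi; rewrite ler_wpM2l.
have key (p q r s c1 c2 : R) : `|p - q| <= c1 -> `|q - r| <= e / 3 ->
    `|r - s| <= c2 -> c1 <= e / 3 -> c2 <= e / 3 -> `|p - s| <= e.
  have := ler_distD q p s; have := ler_distD r q s; lra.
exact: key dint H1 dav k1 k2.
Qed.

End tame_to_Ce.

Theorem theorem1p1 (R : realType)
  (d : measure_display) (Omega : measurableType d) (P : probability Omega R)
  (M : nat -> {RV P >-> R})
  (W : R -> {RV P >-> R}) (hW : standard_brownian_motion W)
  (b : nat -> R) (b0_ge0 : 0 <= b 0%N) (b_incr : forall n, b n < b n.+1)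
  (b_oo : b n @[n --> \oo] --> +oo)
  (b_gap : (fun n => b n.+1 - b n) =o_\oo (fun n => b n / ln (ln (b n))))
  (hMW : {ae P, forall w,
     (fun n => M n w - W (b n) w) =o_\oo (fun n => Num.sqrt (b n))})
  (d' : measure_display) (Omega' : measurableType d')
  (Q : probability Omega' R) (Z : {RV Q >-> R})
  (hZ : normally_distributed Q Z 0 1)
  (f : R -> R) (hf : class_Ce f) :
  {ae P, forall w,
    ((ln (b n))^-1 *
      \sum_(1 <= k < n.+1)
        (b k - b k.-1) / b k * f (M k w / Num.sqrt (b k)))%:E
      @[n --> \oo] --> 'E_Q[f \o Z]%E}.
Proof.
have gap0 (e : R) : 0 < e -> \forall n \near \oo, b n.+1 - b n <= e * b n.
  move=> e0; have := littleo_nearP b_gap e0.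
  have lnb := ln_scale_oo b_oo.
  have /cvgryPge/(_ (expR 1)) := lnb.
  apply: filterS2 => n lb; rewrite ger0_norm; last by rewrite subr_ge0 ltW.
  move/le_trans; apply.
  apply: ler_wpM2l; first exact: ltW.
  have bn0 : 0 <= b n by exact: scale_ge0.
  have lnln1 : 1 <= ln (ln (b n)).
    rewrite -[1]expRK ler_ln ?posrE ?expR_gt0//.
    exact: lt_le_trans (expR_gt0 _) lb.
  have lnln0 : 0 < ln (ln (b n)) by exact: lt_le_trans ltr01 lnln1.
  rewrite ger0_norm; last by rewrite divr_ge0// ltW.
  by rewrite ler_pdivrMr// ler_peMr.
pose a := log_weight b.
have a_ge0 : forall k, 0 <= a k by exact: log_weight_ge0.
have a_le1 : forall k, a k <= 1 by exact: log_weight_le1.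
have A_oo : \sum_(k < n) a k @[n --> \oo] --> +oo by exact: total_weight_oo.
pose X := rescaled W b.
have nX : forall k, std_normal P (X k) by exact: std_normal_rescaled.
have decX : decoupled P a X by exact: brownian_decoupled.
have [l [l0 l2 fle happ]] := class_Ce_tame_approx hf.
have /boolp.choice[G HG] : forall i : nat, exists G, tame l G /\
    forall x, `|f x - G x| <= i.+1%:R^-1 * gexp l x.
  by move=> i; have [//|G tG fG] := happ (i.+1%:R^-1); exists G.
have [tG fG] : (forall i, tame l (G i)) /\
    (forall i x, `|f x - G i x| <= i.+1%:R^-1 * gexp l x).
  by split=> i; case: (HG i).
(* room for the losses of exponent: [gexp l] is tame at [l1], perturbations cost
   a weight of exponent [l3], and this weight is itself tame at [l4] *)
pose l1 := (l + 1 / 2) / 2; pose l3 := (l1 + 1 / 2) / 2; pose l4 := (l3 + 1 / 2) / 2.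
have [h1 h3 h4 h5] : [/\ l < l1, l1 < l3, l3 < l4 & l4 < 1 / 2].
  by rewrite /l4 /l3 /l1; split; lra.
have l1_0 : 0 <= l1 by lra.
have l3_0 : 0 <= l3 by lra.
have l4_0 : 0 <= l4 by lra.
have l1_2 : l1 < 1 / 2 by lra.
have aeG : {ae P, forall w, forall i,
    (\sum_(k < n) a k * G i (X k w)) / (\sum_(k < n) a k) @[n --> \oo] -->
    \int[normal_prob 0 1]_x G i x}.
  by apply: ae_foralln => i; exact: tame_average l0 l2 (tG i).
have aeg := tame_average a_ge0 a_le1 A_oo nX decX l1_0 l1_2 (tame_gexp l0 h1).
have aeg' := tame_average a_ge0 a_le1 A_oo nX decX l4_0 h5 (tame_gexp l3_0 h4).
have mf : measurable_fun setT f by case: hf => cf _; exact: continuous_measurable_fun.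
have iF : (@normal_prob R 0 1).-integrable setT (EFin \o f).
  exact: (@le_integrable_fun R _ (measurableTypeR R) _ _ _ mf fle (integrable_gexp l2)).
have -> : ('E_Q[f \o Z] = (\int[normal_prob 0 1]_x f x)%:E)%E.
  have mZ : measurable_fun setT Z by [].
  have [_ e] := normal_integral_comp mZ hZ mf iF.
  rewrite unlock /= e /Rintegral fineK//.
  exact: (integrable_fin_num measurableT iF).
apply: filterS3 (filterI hMW (bm_start hW)) aeG (filterI aeg aeg').
move=> w [MW W0] Gw [gw gw'].
pose Y k := M k.+1 w / Num.sqrt (b k.+1).
have XY : X k w - Y k @[k --> \oo] --> 0.
  apply/cvgrPdist_le => e e0.
  have [K _ HK] := littleo_nearP MW e0.
  exists K => // k /= Kk; have := HK k.+1 (leqW Kk).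
  rewrite sub0r normrN /X /rescaled /Y W0 subr0 -mulrBl normrM normfV distrC.
  rewrite ler_pdivrMr// normr_gt0 gt_eqF// sqrtr_gt0.
  exact: scale_gt0.
have GY i := cvg_tame_average_perturb a_ge0 A_oo l0 (lt_trans h1 h3) (tG i) XY gw' (Gw i).
have gY := cvg_tame_average_perturb a_ge0 A_oo l1_0 h3 (tame_gexp l0 h1) XY gw' gw.
have fY := cvg_average_approx a_ge0 A_oo l2 iF tG fG gY GY.
apply: cvg_EFin; first exact: nearW.
have prod_cvg : (\sum_(k < n) a k) / ln (b n) *
    ((\sum_(k < n) a k * f (Y k)) / \sum_(k < n) a k) @[n --> \oo] -->
    \int[normal_prob 0 1]_x f x.
  rewrite -[X in _ --> X]mul1r; apply: cvgM => //; exact: total_weight_equiv.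
apply: cvg_trans prod_cvg; apply: near_eq_cvg.
have /cvgryPge/(_ 1) := A_oo.
apply: filterS => n An /=.
have A0 : \sum_(k < n) a k != 0 by rewrite gt_eqF// (lt_le_trans ltr01 An).
rewrite big_add1/= big_mkord mulrC mulrA divfK// mulrC.
by congr (_ * _); apply: eq_bigr.
Qed.
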